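(* Let $n\ge 1$. 1. Let $\mu$ be an unconditional $\log$-concave measure on $\mathbb{R}^n$ and let $A$ be an unconditional convex subset of $\mathbb{R}^n$. Then, for every $A_1, A_2 \in \{\alpha A : \alpha > 0\}$ and for every $\lambda \in [0,1]$, $$ \mu((1-\lambda)A_1 + \lambda A_2)^{\frac{1}{n}} \geq (1-\lambda)\, \mu(A_1)^{\frac{1}{n}} + \lambda\, \mu(A_2)^{\frac{1}{n}}. $$ 2. Let $\mu_i$, $1 \leq i \leq n$, be measures on $\mathbb{R}$ with densities $\phi_i : \mathbb{R} \to \mathbb{R}_+$ (with respect to Lebesgue measure) such that each $\phi_i$ is non-decreasing on $(-\infty, 0]$ and non-increasing on $[0, +\infty)$. Let $\mu$ be the product measure of $\mu_1, \dots, \mu_n$ on $\mathbb{R}^n$, and let $A,B \subset \mathbb{R}^n$ each be a product of $n$ Borel subsets of $\mathbb{R}$, such that $0 \in A \cap B$. Then, for every $\lambda \in [0,1]$, $$ \mu((1-\lambda) A + \lambda B)^{\frac{1}{n}} \geq (1-\lambda)\, \mu(A)^{\frac{1}{n}} + \lambda\, \mu(B)^{\frac{1}{n}}. $$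
   Context: $\mathbb{R}_+=[0,+\infty)$. For sets $A,B\subset\mathbb{R}^n$, $A+B=\{a+b : a\in A, b\in B\}$ is the Minkowski sum, and $\alpha A=\{\alpha a : a\in A\}$ for real $\alpha$. A function $f:\mathbb{R}^n\to\mathbb{R}$ is unconditional if $f(\varepsilon_1x_1,\dots,\varepsilon_nx_n)=f(x_1,\dots,x_n)$ for every $(x_1,\dots,x_n)\in\mathbb{R}^n$ and every $(\varepsilon_1,\dots,\varepsilon_n)\in\{-1,1\}^n$. A set $A\subset\mathbb{R}^n$ is unconditional if its indicator function $1_A$ is unconditional. A measure on $\mathbb{R}^n$ having a density function (with respect to Lebesgue measure) is unconditional if its density function is unconditional. A measure $\mu$ on $\mathbb{R}^n$ is $\log$-concave if $\mu((1-\lambda)A+\lambda B)\ge \mu(A)^{1-\lambda}\mu(B)^{\lambda}$ for all Borel sets $A,B\subset\mathbb{R}^n$ with $\mu(A)\mu(B)>0$ and every $\lambda\in[0,1]$. *)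

(* Defs.v *)
From HB Require Import structures.
From mathcomp Require Import all_boot all_order all_algebra.
From mathcomp Require Import all_classical all_reals all_analysis.

Set Implicit Arguments.
Unset Strict Implicit.
Unset Printing Implicit Defensive.

Import Order.TTheory GRing.Theory Num.Theory.
Import numFieldNormedType.Exports.

Local Open Scope classical_set_scope.
Local Open Scope ring_scope.

Definition measure_rV_display : measure_display -> measure_display.
Proof. exact. Qed.

(* 'rV[T]_n carries the sigma-algebra generated by its n coordinates, as the
   library does for n.-tuple T; for T = R this is the Borel sigma-algebra of
   R^n. *)
Section measurable_rV.
Context d (T : measurableType d) (n : nat).

Let coord (i : 'I_n) (x : 'rV[T]_n) : T := x ord0 i.

Let rV_set0 : g_sigma_preimage coord set0.
Proof. exact: sigma_algebra0. Qed.

Let rV_setC A : g_sigma_preimage coord A -> g_sigma_preimage coord (~` A).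
Proof. exact: sigma_algebraC. Qed.

Let rV_bigcup (F : _^nat) : (forall i, g_sigma_preimage coord (F i)) ->
  g_sigma_preimage coord (\bigcup_i F i).
Proof. exact: sigma_algebra_bigcup. Qed.

HB.instance Definition _ := @isMeasurable.Build (measure_rV_display d)
  'rV[T]_n (g_sigma_preimage coord) rV_set0 rV_setC rV_bigcup.

Lemma measurable_coord (i : 'I_n) : measurable_fun [set: 'rV[T]_n] (coord i).
Proof.
move=> _ Y mY; rewrite setTI; apply: sub_sigma_algebra => /=.
rewrite -bigcup_seq/=; exists i => /=; first by rewrite mem_index_enum.
by exists Y => //; rewrite setTI.
Qed.

Lemma measurable_fun_rV d' (S : measurableType d') (f : S -> 'rV[T]_n) :
  (forall i, measurable_fun [set: S] (fun s => f s ord0 i)) ->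
  measurable_fun [set: S] f.
Proof.
move=> mf.
suff fS : g_sigma_preimage (fun i => coord i \o f) `<=` measurable.
  move=> _ A mA; rewrite setTI; apply: fS.
  by rewrite g_sigma_preimage_comp; exists A => //; rewrite setTI.
apply: smallest_sub; first exact: sigma_algebra_measurable.
by rewrite -bigcup_seq => A [i _] [B mB <-]; exact: mf.
Qed.

End measurable_rV.

Lemma product_measure_sigma_finite d1 d2 (T1 : measurableType d1)
    (T2 : measurableType d2) (R : realType)
    (m1 : {sigma_finite_measure set T1 -> \bar R})
    (m2 : {sigma_finite_measure set T2 -> \bar R}) :
  sigma_finite [set: T1 * T2] (m1 \x m2)%E.
Proof.
have /sigma_finiteP[F [TF ndF Foo]] := sigma_finiteT m1.
have /sigma_finiteP[G [TG ndG Goo]] := sigma_finiteT m2.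
exists (fun n => F n `*` G n).
  rewrite -setXTT TF TG predeqE => -[x y]; split.
    move=> [/= [n _ Fnx] [k _ Gky]]; exists (maxn n k) => //; split.
    - by move: x Fnx; exact/subsetPset/ndF/leq_maxl.
    - by move: y Gky; exact/subsetPset/ndG/leq_maxr.
  by move=> [n _ []/= ? ?]; split; exists n.
move=> k; have [? ?] := Foo k; have [? ?] := Goo k.
split; first exact: measurableX.
by rewrite product_measure1E// lte_mul_pinfty// ge0_fin_numE.
Qed.

Section lebesgue_rV.
Context (R : realType).

Let cons_rV n (p : measurableTypeR R * 'rV[R]_n) : 'rV[R]_n.+1 :=
  row_mx (p.1)%:M p.2 : 'rV[R]_(1 + n).

Let uncons_rV n (x : 'rV[R]_n.+1) : measurableTypeR R * 'rV[R]_n :=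
  (x ord0 ord0, rsubmx (x : 'rV[R]_(1 + n))).

Let cons_rVK n : cancel (@cons_rV n) (@uncons_rV n).
Proof.
case=> a x; rewrite /uncons_rV /cons_rV row_mxKr/=; congr pair.
have -> : @ord0 n = lshift n (@ord0 0) by exact/val_inj.
by rewrite (@row_mxEl _ 1 1 n) mxE eqxx.
Qed.

Let uncons_rVK n : cancel (@uncons_rV n) (@cons_rV n).
Proof.
move=> x; apply/rowP => i; rewrite /uncons_rV /cons_rV/=.
case: (@splitP 1 n i) => j ij.
- have -> : i = lshift n j by exact/val_inj.
  rewrite (@row_mxEl _ 1 1 n) mxE !ord1 eqxx mulr1n.
  by congr (x _ _); exact/val_inj.
- have -> : i = rshift 1 j by exact/val_inj.
  by rewrite (@row_mxEr _ 1 1 n) mxE.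
Qed.

Let measurable_cons_rV n : measurable_fun setT (@cons_rV n).
Proof.
apply: measurable_fun_rV => i.
case: (@splitP 1 n i) => j ij.
- have -> : i = lshift n j by exact/val_inj.
  rewrite (_ : (fun _ => _) = fst)//.
  by apply/funext => p; rewrite /cons_rV (@row_mxEl _ 1 1 n) mxE !ord1 eqxx mulr1n.
- have -> : i = rshift 1 j by exact/val_inj.
  rewrite (_ : (fun _ => _) = (fun x : 'rV[R]_n => x ord0 j) \o snd).
    by apply: measurableT_comp => //; exact: measurable_coord.
  by apply/funext => p; rewrite /cons_rV (@row_mxEr _ 1 1 n).
Qed.

Let measurable_uncons_rV n : measurable_fun setT (@uncons_rV n).
Proof.
apply/measurable_fun_pairP; split; first exact: measurable_coord.
apply: measurable_fun_rV => i /=.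
rewrite (_ : (fun _ => _) = (fun x : 'rV[R]_n.+1 => x ord0 (rshift 1 i))).
  exact: measurable_coord.
by apply/funext => x; rewrite mxE.
Qed.

Section step.
Variables (n : nat) (m1 : {sigma_finite_measure set (measurableTypeR R) -> \bar R}).
Variable mu : {sigma_finite_measure set 'rV[R]_n -> \bar R}.

Definition product_step : set 'rV[R]_n.+1 -> \bar R :=
  pushforward (m1 \x mu)%E (@cons_rV n).

Let step0 : product_step set0 = 0%E.
Proof. by rewrite /product_step /pushforward preimage_set0 measure0. Qed.

Let step_ge0 A : (0 <= product_step A)%E.
Proof. by rewrite /product_step /pushforward measure_ge0. Qed.

Let step_sigma_additive : semi_sigma_additive product_step.
Proof.
move=> F mF tF mUF; rewrite /product_step /pushforward preimage_bigcup.
have mpre B : measurable B -> measurable (@cons_rV n @^-1` B).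
  by move=> mB; rewrite -[X in measurable X]setTI; exact: measurable_cons_rV.
apply: measure_semi_sigma_additive.
- by move=> k; exact: mpre.
- apply/trivIsetP => /= i j _ _ ij; rewrite -preimage_setI.
  by move/trivIsetP : tF => /(_ _ _ _ _ ij) ->//; rewrite preimage_set0.
- by rewrite -preimage_bigcup; exact: mpre.
Qed.

HB.instance Definition _ := isMeasure.Build _ _ _ product_step
  step0 step_ge0 step_sigma_additive.

Let step_sigma_finite : sigma_finite setT product_step.
Proof.
have [F FT mF] := product_measure_sigma_finite m1 mu.
exists (fun k => @uncons_rV n @^-1` F k).
  by rewrite -preimage_bigcup -FT preimage_setT.
move=> k; have [mFk Fk] := mF k; split.
  by rewrite -[X in measurable X]setTI; exact: measurable_uncons_rV.
rewrite /product_step /pushforward -comp_preimage.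
rewrite (_ : _ \o _ = id); last by apply/funext => p /=; rewrite cons_rVK.
by rewrite preimage_id.
Qed.

HB.instance Definition _ := Measure_isSigmaFinite.Build _ _ _ product_step
  step_sigma_finite.

End step.

Fixpoint lebesgue_rV n : {sigma_finite_measure set 'rV[R]_n -> \bar R} :=
  match n with
  | 0 => dirac (0 : 'rV[R]_0)
  | n'.+1 => product_step (@lebesgue_measure R) (lebesgue_rV n')
  end.

End lebesgue_rV.

Section product_measure.
Context (R : realType) (n : nat).

Definition box (A : 'I_n -> set R) : set 'rV[R]_n :=
  [set x | forall i, A i (x ord0 i)].

(* For sigma-finite factors this determines mu uniquely. *)
Definition is_product_measure
    (mu_ : 'I_n -> {measure set (measurableTypeR R) -> \bar R})
    (mu : {measure set 'rV[R]_n -> \bar R}) :=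
  forall A : 'I_n -> set (measurableTypeR R), (forall i, measurable (A i)) ->
    mu (box A) = (\prod_(i < n) mu_ i (A i))%E.

End product_measure.

Lemma measurable_box (R : realType) n (A : 'I_n -> set R) :
  (forall i, measurable (A i)) -> measurable (box A).
Proof.
move=> mA.
have mcA i : measurable ((fun x : 'rV[R]_n => x ord0 i) @^-1` A i).
  by rewrite -[X in measurable X]setTI; exact: measurable_coord.
rewrite (_ : box A = \big[setI/setT]_(i < n)
    ((fun x : 'rV[R]_n => x ord0 i) @^-1` A i)); first exact: bigsetI_measurable.
apply/seteqP; split => x; rewrite -bigcap_seq /box /= => xA i.
  by move=> _; exact: xA.
by apply: xA => /=; exact: mem_index_enum.
Qed.

Lemma lebesgue_rV_product (R : realType) (n : nat) :
  is_product_measure (fun=> @lebesgue_measure R) (@lebesgue_rV R n).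
Proof.
elim: n => [|n IH] A mA.
  by rewrite big_ord0 /= diracE mem_set// => -[].
rewrite big_ord_recl -(IH (fun i => A (lift ord0 i)))//.
rewrite -product_measure1E//; last first.
  apply: (@measurable_box R n (fun i => A (lift ord0 i))) => i; exact: mA.
rewrite /= /product_step /pushforward; congr (_ _).
have E0 : @ord0 n = lshift n (@ord0 0) by exact/val_inj.
have ES (i : 'I_n) : lift ord0 i = rshift 1 i by exact/val_inj.
apply/seteqP; split => -[a x]; rewrite /box /=.
  move=> aA; split=> [|i].
    by move: (aA ord0); rewrite {2}E0 (@row_mxEl _ 1 1 n) mxE eqxx mulr1n.
  by move: (aA (lift ord0 i)); rewrite {2}ES (@row_mxEr _ 1 1 n).
move=> [aA xA] i; case: (unliftP ord0 i) => [j ->|->].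
  by rewrite {2}ES (@row_mxEr _ 1 1 n).
by rewrite {2}E0 (@row_mxEl _ 1 1 n) mxE eqxx mulr1n.
Qed.

Section unconditional.
Context (R : realType) (n : nat).

Definition unconditional_fun (f : 'rV[R]_n -> R) :=
  forall (x : 'rV[R]_n) (eps : 'I_n -> R),
    (forall i, eps i = -1 \/ eps i = 1) ->
    f (\row_i (eps i * x ord0 i)) = f x.

Definition unconditional_set (A : set 'rV[R]_n) :=
  unconditional_fun (\1_A : 'rV[R]_n -> R).

End unconditional.

Definition has_density d (T : measurableType d) (R : realType)
    (nu mu : {measure set T -> \bar R}) (phi : T -> R) :=
  [/\ forall x, 0 <= phi x,
      measurable_fun [set: T] phi &
      forall A, measurable A -> mu A = (\int[nu]_(x in A) (phi x)%:E)%E].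

Definition unconditional_measure (R : realType) (n : nat)
    (mu : {measure set 'rV[R]_n -> \bar R}) :=
  exists2 phi : 'rV[R]_n -> R,
    has_density (@lebesgue_rV R n) mu phi & unconditional_fun phi.

Section minkowski.
Context (R : realType) (n : nat).
Implicit Types A B : set 'rV[R]_n.

Definition minkowski_sum A B : set 'rV[R]_n := [set a + b | a in A & b in B].

Definition dilate (a : R) A : set 'rV[R]_n := [set a *: x | x in A].

End minkowski.

(* The Minkowski sum of two Borel sets is analytic but need not be Borel, and a
   convex set need not be Borel either.  For a measure having a density with
   respect to Lebesgue measure such sets are measurable for its completion; the
   completed measure is the restriction of the library's outer measure mu^*,
   which agrees with mu on Borel sets.  Hence mu^* below, where the library's
   mu carries no information outside the Borel sets. *)
Local Open Scope measure_scope.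

Definition log_concave_measure (R : realType) (n : nat)
    (mu : {measure set 'rV[R]_n -> \bar R}) :=
  forall (A B : set 'rV[R]_n) (l : R),
    measurable A -> measurable B -> (0 < mu A * mu B)%E -> 0 <= l <= 1 ->
    (mu A `^ (1 - l) * mu B `^ l <=
     mu^* (minkowski_sum (dilate (1 - l) A) (dilate l B)))%E.

(* Main.v *)
(* Part 1. Put F a = mu^* (a A). By log-concavity applied to a box and its mirror
   image, mu decreases when a box of the positive orthant moves away from the
   coordinate hyperplanes, so a smaller, lower box has a larger average; this
   gives F (s a) >= s ^ n F a for s <= 1. Comparing geometric with arithmetic
   means, mu then satisfies a multiplicative Prekopa-Leindler inequality on pairs
   of thin boxes of the orthant, up to a factor tending to 1 with the thickness.
   The cutting argument of Hadwiger and Ohmann extends it to finite unions of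
   boxes, and exhausting A by a geometric grid yields
   F (a ^ (1 - l) b ^ l) >= F a ^ (1 - l) F b ^ l. Together with the monotonicity
   of F and of F a / a ^ n, this makes F ^ (1 / n) concave.

   Part 2. On the line, the level sets of phi are intervals around 0, inside which
   the one-dimensional Brunn-Minkowski inequality applies; integrating over the
   levels gives mu_i ((1 - l) A + l B) >= (1 - l) mu_i A + l mu_i B, and the
   arithmetic-geometric mean inequality multiplies these bounds over i. *)

Require Import Defs.
From HB Require Import structures.
From mathcomp Require Import all_boot all_order all_algebra.
From mathcomp Require Import all_classical all_reals all_analysis.
From mathcomp Require Import measurable_realfun.
From mathcomp Require Import ring lra.

Import Order.TTheory GRing.Theory Num.Theory.
Import numFieldNormedType.Exports.

Local Open Scope classical_set_scope.
Local Open Scope ring_scope.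
Local Open Scope measure_scope.

Set Implicit Arguments.
Unset Strict Implicit.
Unset Printing Implicit Defensive.

(** * Averages of decreasing set functions *)

(** For a log-concave density one would substitute x_i = exp t_i and apply the Prekopa-Leindler
    inequality. Here log-concavity is a statement about masses of Borel sets, and a density is
    determined only almost everywhere, so the substitution is carried out on masses of boxes: a thin
    box stands for a point, the geometric grid is the image of a uniform grid in t, and a factor
    [rho ^+ n] is the volume lost when the corners of a box are divided by [rho]. Unconditionality
    confines the work to the open orthant, where logarithms exist: the other orthants contribute
    equal masses and the coordinate hyperplanes none. Since a dilate of A may fail to be Borel, its
    outer measure is reached only through finitely many boxes inside it, at the cost of a dilation
    by [expR h]. All these losses disappear as h tends to 0. *)

Section decreasing_average.
Context (R : realType) (f : R -> R -> \bar R).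
Hypothesis f_ge0 : forall a b, (0 <= f a b)%E.
Hypothesis fxx : forall a, f a a = 0%E.
Hypothesis fD : forall a b c : R, 0 <= a -> a <= b -> b <= c ->
  f a c = (f a b + f b c)%E.
Hypothesis f_shift : forall a b s : R, 0 <= s <= a -> a <= b ->
  (f a b <= f (a - s) (b - s))%E.

Let mulSe (k : nat) (v : \bar R) : (0 <= v)%E ->
  (k.+1%:R%:E * v = k%:R%:E * v + v)%E.
Proof. by move=> v0; rewrite -natr1 EFinD ge0_muleDl// mul1e. Qed.

Let f_mulrn_le (y d : R) (k : nat) : 0 <= y -> 0 <= d ->
  (f y (y + k%:R * d) <= k%:R%:E * f y (y + d))%E.
Proof.
move=> y0 d0; elim: k => [|k IH]; first by rewrite mul0r addr0 fxx mul0e.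
have kd : 0 <= k%:R * d by rewrite mulr_ge0.
have ykd : y + k%:R * d <= y + k.+1%:R * d by rewrite -natr1; lra.
rewrite (fD y0 _ ykd) ?lerDl// mulSe// leeD//.
have := @f_shift (y + k%:R * d) (y + k.+1%:R * d) (k%:R * d).
rewrite kd lerDr => /(_ y0 ykd); rewrite addrK.
suff -> : y + k.+1%:R * d - k%:R * d = y + d by [].
by rewrite -natr1; ring.
Qed.

Let f_mulrn_ge (x y d : R) (k : nat) : 0 <= x -> 0 <= d -> x + k%:R * d <= y ->
  (k%:R%:E * f y (y + d) <= f x (x + k%:R * d))%E.
Proof.
move=> x0 d0; elim: k => [|k IH] xky; first by rewrite mul0r addr0 fxx mul0e.
have kd : 0 <= k%:R * d by rewrite mulr_ge0.
have xkd : x + k%:R * d <= x + k.+1%:R * d by rewrite -natr1; lra.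
rewrite (fD x0 _ xkd) ?lerDl// mulSe// leeD//.
  exact/IH/(le_trans xkd).
have := @f_shift y (y + d) (y - (x + k%:R * d)).
rewrite subr_ge0 (le_trans xkd xky) lerDl gerBl addr_ge0// => /(_ isT d0).
by rewrite subKr; congr (_ <= f _ _)%E; rewrite -natr1; ring.
Qed.

(** Read [f a b] as the mass of [a, b). Cut [a', b') into N pieces of length d; each is at least as
    heavy as [a, a + d). The interval [a, b) is covered by K pieces of length d, none heavier than
    [a, a + d). As K <= l N / l' + 1, the rounding error vanishes when N grows. *)
Let avg_disjoint (a b a' b' : R) : 0 <= a' -> a' <= b' -> b' <= a -> a <= b ->
  ((b' - a')%:E * f a b <= (b - a)%:E * f a' b')%E.
Proof.
move=> a'0; rewrite le_eqVlt => /predU1P[->|ab' b'a].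
  by rewrite subrr mul0e fxx mule0.
rewrite le_eqVlt => /predU1P[->|ab]; first by rewrite fxx mule0 subrr mul0e.
have a0 : 0 <= a by rewrite (le_trans a'0)// (le_trans (ltW ab')).
set l := b - a; set l' := b' - a'.
have l0 : 0 < l by rewrite subr_gt0.
have l'0 : 0 < l' by rewrite subr_gt0.
have key (N : nat) : (0 < N)%N ->
    (N%:R%:E * f a b <= (l * N%:R / l' + 1)%:E * f a' b')%E.
  move=> N0; have NR : 0 < N%:R :> R by rewrite ltr0n.
  pose d := l' / N%:R; have d0 : 0 < d by rewrite divr_gt0.
  pose K := (Num.trunc (l / d)).+1.
  have ldK : l / d < K%:R by exact: truncnS_gt.
  have Kle : K%:R <= l * N%:R / l' + 1.
    rewrite -natr1 lerD2r (_ : l * N%:R / l' = l / d).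
      by rewrite truncn_le divr_ge0// ltW.
    by rewrite /d; field; rewrite gt_eqF//= gt_eqF.
  have NM' : (N%:R%:E * f a (a + d) <= f a' b')%E.
    have -> : b' = a' + N%:R * d.
      by rewrite /d /l'; field; rewrite gt_eqF.
    apply: f_mulrn_ge => //; first exact: ltW.
    suff -> : a' + N%:R * d = b' by [].
    by rewrite /d /l'; field; rewrite gt_eqF.
  have MK : (f a b <= K%:R%:E * f a (a + d))%E.
    apply: le_trans (f_mulrn_le K a0 (ltW d0)).
    have bK : b <= a + K%:R * d.
      by rewrite addrC -lerBlDr -ler_pdivrMr// ltW.
    by rewrite (fD a0 (ltW ab) bK) leeDl.
  apply: (@le_trans _ _ (K%:R%:E * f a' b')%E); last first.
    by rewrite lee_wpmul2r.
  apply: (@le_trans _ _ (N%:R%:E * (K%:R%:E * f a (a + d)))%E).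
    by rewrite lee_wpmul2l.
  by rewrite muleCA lee_wpmul2l.
move: key; case: (f a' b') (f_ge0 a' b') => [m'| |]// m'0 key; last first.
  by rewrite gt0_muley ?lte_fin// leey.
have := key 1%N isT; rewrite mul1e.
move: key; case: (f a b) (f_ge0 a b) => [m| |]// m0 key _.
rewrite -!EFinM lee_fin; apply/ler_addgt0Pr => e e0.
have le0 : 0 <= l' * m' / e.
  by rewrite divr_ge0 ?mulr_ge0// ltW.
pose N := (Num.trunc (l' * m' / e)).+1.
have NR : 0 < N%:R :> R by rewrite ltr0n.
have := key N isT; rewrite -!EFinM lee_fin => keyN.
have : l' * m' / e < N%:R by exact: truncnS_gt.
rewrite ltr_pdivrMr// => Ne.
rewrite -(ler_pM2l NR).
have -> : N%:R * (l' * m) = l' * (N%:R * m) by ring.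
apply: (@le_trans _ _ (l' * ((l * N%:R / l' + 1) * m'))).
  by rewrite ler_pM2l.
have -> : l' * ((l * N%:R / l' + 1) * m') = l * N%:R * m' + l' * m'.
  by field; rewrite gt_eqF.
lra.
Qed.

Lemma decreasing_average (a b a' b' : R) :
    0 <= a' <= a -> a' <= b' -> a <= b -> b' <= b ->
  ((b' - a')%:E * f a b <= (b - a)%:E * f a' b')%E.
Proof.
move=> /andP[a'0 a'a] a'b' ab b'b; have a0 := le_trans a'0 a'a.
have [b'a|/ltW ab'] := leP b' a; first exact: avg_disjoint.
rewrite (fD a0 ab' b'b) (fD a'0 a'a ab').
have b'0 := le_trans a'0 a'b'.
(* The intervals overlap in [a, b'). The three consecutive pieces [a', a), [a, b'), [b', b) are
   compared in pairs and the results added; the product of length and mass of the overlap occurs on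
   both sides. *)
have H1 := avg_disjoint a'0 a'a (lexx a) ab'.
have H2 := avg_disjoint a0 ab' (lexx b') b'b.
have H3 := avg_disjoint a'0 a'a ab' b'b.
have -> : b' - a' = (a - a') + (b' - a) by ring.
have -> : b - a = (b' - a) + (b - b') by ring.
have [P0 Q0 S0] : [/\ 0 <= a - a', 0 <= b' - a & 0 <= b - b'].
  by rewrite !subr_ge0.
move: H1 H2 H3 (f_ge0 a' a) (f_ge0 a b') (f_ge0 b' b).
move: P0 Q0 S0; move: (a - a') (b' - a) (b - b') => P Q S P0 Q0 S0.
move: (f a' a) (f a b') (f b' b) => p q r H1 H2 H3 p0 q0 r0.
rewrite !EFinD !ge0_muleDl ?lee_fin// !ge0_muleDr//.
rewrite -[leRHS]addeA [X in (_ <= _ + X)%E]addeCA [leRHS]addeCA.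
rewrite -[leLHS]addeA [leLHS]addeCA [X in (_ + X <= _)%E]addeC -addeA.
apply: leeD => //; rewrite [leRHS]addeCA; apply: leeD => //.
by rewrite addeC; exact: leeD.
Qed.

End decreasing_average.

(** * Reflections and hyperplanes *)

Section measure_rV.
Context (R : realType) (n : nat).
Implicit Types (mu : {measure set 'rV[R]_n -> \bar R}).

Lemma boxI (A B : 'I_n -> set R) : box A `&` box B = box (fun i => A i `&` B i).
Proof.
apply/seteqP; split=> [x [xA xB] i|x xAB]; first by split; [exact: xA|exact: xB].
by split=> i; have [] := xAB i.
Qed.

Let cube (k : nat) : set 'rV[R]_n := box (fun=> `[- k%:R, k%:R]%classic).

Lemma measure_rV_unique (m1 m2 : {measure set 'rV[R]_n -> \bar R}) :
  (forall A : 'I_n -> set R, (forall i, measurable (A i)) ->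
    m1 (box A) = m2 (box A)) ->
  (forall k : nat, (m1 (cube k) < +oo)%E) ->
  forall A, measurable A -> m1 A = m2 A.
Proof.
move=> m12 m1oo A mA.
pose G := [set B | exists2 A : 'I_n -> set R,
  (forall i, measurable (A i)) & B = box A].
apply: (@measure_unique _ _ _ G cube) => //.
- apply/seteqP; split.
    apply: smallest_sub; first exact: smallest_sigma_algebra.
    rewrite -bigcup_seq => B [i _] [C mC <-].
    apply: sub_sigma_algebra.
    exists (fun j => if j == i then C else setT).
      by move=> j; case: ifP.
    rewrite setTI; apply/seteqP; split=> [x Cx j|x /(_ i)/=].
      by case: ifP => // /eqP ->.
    by rewrite eqxx.
  apply: smallest_sub; first exact: sigma_algebra_measurable.
  by move=> _ [C mC ->]; exact: measurable_box.
- move=> _ _ [B mB ->] [C mC ->]; rewrite boxI.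
  by exists (fun i => B i `&` C i) => // i; exact: measurableI.
- by move=> k; exists (fun=> `[- k%:R, k%:R]%classic).
- apply/seteqP; split=> // x _.
  exists (\sum_i (Num.trunc `|x ord0 i|).+1)%N => // i /=.
  rewrite in_itv/= -ler_norml (le_trans (ltW (truncnS_gt _)))// ler_nat.
  by rewrite (bigD1 i)//= leq_addr.
- by move=> _ [B mB ->]; exact: m12.
Qed.

Definition flip (eps : 'I_n -> R) (x : 'rV[R]_n) := \row_i (eps i * x ord0 i).

Lemma measurable_flip eps : measurable_fun setT (flip eps).
Proof.
apply: measurable_fun_rV => i.
under eq_fun do rewrite mxE.
by apply: measurable_funM => //; exact: measurable_coord.
Qed.

Lemma lebesgue_rV_flip eps A : (forall i, eps i = -1 \/ eps i = 1) ->
  measurable A -> lebesgue_rV R n (flip eps @^-1` A) = lebesgue_rV R n A.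
Proof.
move=> eps1 mA.
have eqbox (B : 'I_n -> set R) :
  flip eps @^-1` box B = box (fun i => *%R (eps i) @^-1` B i).
  by apply/seteqP; split => x xB i /=; have := xB i; rewrite /= !mxE.
have meps i (B : set R) : measurable B -> measurable ( *%R (eps i) @^-1` B).
  by move=> mB; rewrite -[X in measurable X]setTI; exact: mulrl_measurable.
pose mflip : {mfun _ >-> _} :=
  HB.pack (flip eps) (isMeasurableFun.Build _ _ _ _ _ (measurable_flip eps)).
apply/esym; apply: (@measure_rV_unique (lebesgue_rV R n)
  (pushforward (lebesgue_rV R n) mflip)) => //.
- move=> B mB; transitivity (lebesgue_rV R n (flip eps @^-1` box B)) => //.
  rewrite eqbox !lebesgue_rV_product//; last by move=> i; exact: meps.
  apply: eq_bigr => i _; case: (eps1 i) => ->.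
    rewrite -[LHS]lebesgue_measureN ?/pushforward//; congr (lebesgue_measure _).
    by apply/seteqP; split=> x/=; rewrite mulN1r.
  by congr (lebesgue_measure _); apply/seteqP; split=> x/=; rewrite mul1r.
- move=> k; rewrite lebesgue_rV_product//.
  rewrite (eq_bigr (fun=> (k%:R + k%:R)%:E)) => [|i _ /=]; last first.
    rewrite lebesgue_measure_itv/= lte_fin.
    case: ltP; first by rewrite -EFinB opprK.
    rewrite le_eqVlt => /predU1P[|]; first by move/eqP; rewrite -addr_eq0 => /eqP ->.
    by move=> /(le_lt_trans (ler0n R k)); rewrite oppr_gt0 ltNge ler0n.
  by rewrite prodEFin ltry.
Qed.

Lemma unconditional_flip mu eps A : unconditional_measure mu ->
  (forall i, eps i = -1 \/ eps i = 1) ->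
  measurable A -> mu (flip eps @^-1` A) = mu A.
Proof.
move=> [phi [phi0 mphi muE] uphi] eps1 mA.
have mfA : measurable (flip eps @^-1` A).
  by rewrite -[X in measurable X]setTI; exact: measurable_flip.
pose mflip : {mfun _ >-> _} :=
  HB.pack (flip eps) (isMeasurableFun.Build _ _ _ _ _ (measurable_flip eps)).
rewrite !muE//.
transitivity (\int[lebesgue_rV R n]_(x in flip eps @^-1` A)
    ((EFin \o phi) \o mflip) x)%E.
  by apply: eq_integral => x _; rewrite /= (uphi x eps).
rewrite -(@ge0_integral_pushforward _ _ _ _ R mflip)//=.
- apply: eq_measure_integral; first exact: measurable_flip.
  by move=> ? B mB BA; exact: lebesgue_rV_flip.
- exact: measurable_flip.
- apply/measurable_EFinP; exact: measurable_funS mphi.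
- by move=> y _; rewrite lee_fin.
Qed.

Definition hyperplane (i : 'I_n) (c : R) : set 'rV[R]_n := [set x | x ord0 i = c].

Definition halfspace (i : 'I_n) (c : R) : set 'rV[R]_n := [set x | x ord0 i < c].

Lemma measurable_hyperplane i c : measurable (hyperplane i c).
Proof.
have := @measurable_coord _ (measurableTypeR R) n i measurableT _ (measurable_set1 c).
by rewrite setTI.
Qed.

Lemma measurable_halfspace i c : measurable (halfspace i c).
Proof.
have := @measurable_coord _ (measurableTypeR R) n i measurableT _
  (measurable_itv `]-oo, c[).
by rewrite setTI; congr measurable; apply/seteqP; split => x /=; rewrite in_itv.
Qed.

Lemma density_hyperplane mu (phi : 'rV[R]_n -> R) (i : 'I_n) (c : R) :
  has_density (lebesgue_rV R n) mu phi ->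
  mu (hyperplane i c) = 0%E.
Proof.
move=> [phi0 mphi muE].
have -> : hyperplane i c =
    box (fun j => if j == i then [set c] else setT).
  apply/seteqP; split=> [x /= xc j|x /(_ i)/=]; last by rewrite eqxx.
  by case: ifP => // /eqP ->.
have mb : measurable (box (fun j => if j == i then [set c] else setT)).
  by apply: measurable_box => j; case: ifP.
rewrite muE//; apply: null_set_integral => //.
  by apply/measurable_EFinP; exact: measurable_funS mphi.
rewrite lebesgue_rV_product; last by move=> j; case: ifP.
by rewrite (bigD1 i)//= eqxx lebesgue_measure_set1 mul0e.
Qed.

End measure_rV.

(** * Log-concave measures on boxes *)

Lemma measurable_flip_preimage (R : realType) n (eps : 'I_n -> R)
    (A : set 'rV[R]_n) :
  measurable A -> measurable (flip eps @^-1` A).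
Proof.
by move=> mA; rewrite -[X in measurable X]setTI; exact: measurable_flip.
Qed.

Section log_concave_boxes.
Context (R : realType) (n : nat) (mu : {measure set 'rV[R]_n -> \bar R}).
Implicit Types (a b : 'I_n -> R).

Definition hbox a b : set 'rV[R]_n := box (fun i => `[a i, b i[%classic).

Lemma measurable_hbox a b : measurable (hbox a b).
Proof. by apply: measurable_box => i; exact: measurable_itv. Qed.

Lemma hboxP a b (x : 'rV[R]_n) :
  hbox a b x <-> forall i, a i <= x ord0 i < b i.
Proof. by split=> xab i; have := xab i; rewrite /= in_itv. Qed.

Definition set_coord a (i : 'I_n) (c : R) := fun j => if j == i then c else a j.

Hypothesis mu_flip : forall eps A, (forall i, eps i = -1 \/ eps i = 1) ->
  measurable A -> mu (flip eps @^-1` A) = mu A.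
Hypothesis mu_lc : log_concave_measure mu.

(** A measurable [C] containing the combinations replaces the outer measure of a Minkowski sum by
    [mu C]. Null sets, which the definition of log-concavity excludes, are harmless: 0 < l < 1 makes
    the left side 0. *)
Lemma log_concave_le (A B C : set 'rV[R]_n) (l : R) : measurable A ->
  measurable B -> measurable C -> 0 < l < 1 ->
  (forall x y, A x -> B y -> C ((1 - l) *: x + l *: y)) ->
  (mu A `^ (1 - l) * mu B `^ l <= mu C)%E.
Proof.
move=> mA mB mC /andP[l0 l1] ABC.
have l1' : 1 - l != 0 by rewrite subr_eq0 gt_eqF.
have [->|A0] := eqVneq (mu A) 0%E; first by rewrite poweR0r// mul0e.
have [->|B0] := eqVneq (mu B) 0%E; first by rewrite poweR0r ?gt_eqF// mule0.
have AB0 : (0 < mu A * mu B)%E by rewrite mule_gt0// lt0e measure_ge0 andbT.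
apply: (le_trans (mu_lc mA mB AB0 _)); first by rewrite !ltW.
rewrite -(measurable_mu_extE mu mC); apply: le_mu_ext.
by move=> _ [_ [x Ax <-] [_ [y By <-] <-]]; exact: ABC.
Qed.

Lemma hbox_log_concave a b a' b' (l : R) : 0 < l < 1 ->
  (mu (hbox a b) `^ (1 - l) * mu (hbox a' b') `^ l <=
   mu (hbox (fun i => ((1 - l) * a i + l * a' i)%R)
            (fun i => ((1 - l) * b i + l * b' i)%R)))%E.
Proof.
move=> /andP[l0 l1]; apply: log_concave_le; rewrite ?l0//;
  do ?exact: measurable_hbox.
move=> x y /hboxP xab /hboxP yab; apply/hboxP => i; rewrite !mxE.
move: (xab i) (yab i) => /andP[? ?] /andP[? ?].
by rewrite lerD ?ltrD ?ler_pM2l ?ltr_pM2l ?subr_gt0.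
Qed.

(* Q and its mirror image in the i-th coordinate have the same mass, and their
   means are the translates of Q towards the mirror. *)
Lemma hbox_shift a b i s : 0 <= s <= a i ->
  (mu (hbox a b) <= mu (hbox (set_coord a i (a i - s)%R) (set_coord b i (b i - s)%R)))%E.
Proof.
move=> /andP[]; rewrite le_eqVlt => /predU1P[<- _|s0 sa].
  by rewrite !subr0 /set_coord; apply: le_measure; rewrite ?inE;
    [exact: measurable_hbox..|move=> x /hboxP xab; apply/hboxP => j];
    case: eqP => [->|_].
have [ba|ab] := leP (b i) (a i).
  rewrite [X in mu X](_ : _ = set0) ?measure0//.
  apply/seteqP; split=> x // /hboxP/(_ i)/andP[ax xb].
  by have := le_lt_trans ax xb; rewrite ltNge ba.
pose eps j : R := if j == i then -1 else 1.
have eps1 j : eps j = -1 \/ eps j = 1 by rewrite /eps; case: eqP; [left|right].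
(* The mean of weight l is translated by l (a_i + b_i) towards the mirror; this l makes that
   distance s. *)
pose l := s / (a i + b i).
have a0 : 0 < a i by exact: lt_le_trans sa.
have b0 : 0 < b i by exact: lt_trans ab.
have ab0 : 0 < a i + b i by exact: addr_gt0.
have l0 : 0 < l by rewrite divr_gt0.
have l1 : l < 1 by rewrite ltr_pdivrMr// mul1r (le_lt_trans sa)// ltrDl.
have ls : l * (a i + b i) = s by rewrite /l divfK ?gt_eqF.
have := @log_concave_le (hbox a b) (flip eps @^-1` hbox a b)
  (hbox (set_coord a i (a i - s)) (set_coord b i (b i - s))) l.
rewrite mu_flip//; last exact: measurable_hbox.
rewrite -poweRD; last first.
  by apply: add_neq0_poweRD_def; rewrite subrK oner_eq0.
rewrite subrK poweRe1//; apply.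
- exact: measurable_hbox.
- by apply: measurable_flip_preimage; exact: measurable_hbox.
- exact: measurable_hbox.
- by rewrite l0.
move=> x y /hboxP xab /hboxP yab; apply/hboxP => j; rewrite !mxE.
move: (xab j) (yab j) => /andP[ax xb]; rewrite !mxE /eps /set_coord.
case: eqP => [ji|_]; last by rewrite mul1r => /andP[ay yb]; nra.
rewrite ji in ax xb *; rewrite mulN1r => /andP[ay yb].
by rewrite -ls; nra.
Qed.

Let slab a b i u v := mu (hbox (set_coord a i u) (set_coord b i v)).

Let slabxx a b i u : slab a b i u u = 0%E.
Proof.
rewrite /slab [X in mu X](_ : _ = set0) ?measure0//.
apply/seteqP; split=> x // /hboxP/(_ i); rewrite /set_coord eqxx => /andP[ax xb].
by have := le_lt_trans ax xb; rewrite ltxx.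
Qed.

Let slabD a b i (u v w : R) : u <= v -> v <= w ->
  slab a b i u w = (slab a b i u v + slab a b i v w)%E.
Proof.
move=> uv vw; rewrite /slab -measureU; [|exact: measurable_hbox..|].
- congr (mu _); apply/seteqP; split=> x.
    move/hboxP => xab; have [xv|vx] := ltP (x ord0 i) v; [left|right];
    apply/hboxP => j; have := xab j; rewrite /set_coord; case: eqP => // -> /andP[? ?].
      by apply/andP.
    by apply/andP.
  case=> /hboxP xab; apply/hboxP => j; have := xab j; rewrite /set_coord;
    case: eqP => // -> /andP[? ?]; apply/andP; split=> //.
    exact: lt_le_trans vw.
  exact: le_trans uv _.
- apply/seteqP; split=> x // -[/hboxP/(_ i) + /hboxP/(_ i)].
  by rewrite /set_coord eqxx => /andP[_ +] /andP[+ _] => /lt_le_trans/[apply]; rewrite ltxx.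
Qed.

Lemma set_coord_set a i (u v : R) : set_coord (set_coord a i u) i v = set_coord a i v.
Proof. by apply/funext => j; rewrite /set_coord; case: eqP. Qed.

Lemma set_coord_id a i : set_coord a i (a i) = a.
Proof. by apply/funext => j; rewrite /set_coord; case: eqP => // ->. Qed.

Let hbox_avg1 a b i (u v : R) : 0 <= u <= a i -> u <= v -> a i <= b i ->
  v <= b i ->
  ((v - u)%:E * mu (hbox a b) <=
   (b i - a i)%:E * mu (hbox (set_coord a i u) (set_coord b i v)))%E.
Proof.
move=> ua uv ab vb.
have -> : mu (hbox a b) = slab a b i (a i) (b i) by rewrite /slab !set_coord_id.
apply: (@decreasing_average R (slab a b i)) => //.
- by move=> *; exact: slabD.
- move=> c d s /andP[s0 sc] cd; rewrite /slab.
  have := @hbox_shift (set_coord a i c) (set_coord b i d) i s.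
  by rewrite !set_coord_set /set_coord eqxx s0 sc; exact.
Qed.

(** Edges are replaced one coordinate at a time while the others stay fixed, and the one-dimensional
    comparisons multiply. Averages are cross-multiplied, so that edges of length 0 are allowed. *)
Lemma hbox_avg a b a' b' : (forall i, 0 <= a' i <= a i) ->
  (forall i, a' i <= b' i) -> (forall i, a i <= b i) ->
  (forall i, b' i <= b i) ->
  ((\prod_i (b' i - a' i))%:E * mu (hbox a b) <=
   (\prod_i (b i - a i))%:E * mu (hbox a' b'))%E.
Proof.
move=> a'a a'b' ab b'b.
pose set_coords (s : seq 'I_n) (c c' : 'I_n -> R) := fun i => if i \in s then c' i else c i.
suff : forall s : seq 'I_n, uniq s ->
    ((\prod_(i <- s) (b' i - a' i))%:E * mu (hbox a b) <=
     (\prod_(i <- s) (b i - a i))%:E *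
       mu (hbox (set_coords s a a') (set_coords s b b')))%E.
  move=> /(_ (index_enum _) (index_enum_uniq _)).
  have set_coords_all (c c' : 'I_n -> R) : set_coords (index_enum _) c c' = c'.
    by apply/funext => i; rewrite /set_coords mem_index_enum.
  by rewrite !set_coords_all.
elim=> [_|i s IH /= /andP[is_ us]].
  by rewrite !big_nil !mul1e.
rewrite !big_cons !EFinM -!muleA.
have p0 (c c' : 'I_n -> R) : (forall i, c i <= c' i) ->
    (0 <= (\prod_(i <- s) (c' i - c i))%:E)%E.
  by move=> cc'; rewrite lee_fin prodr_ge0// => j _; rewrite subr_ge0.
apply: (@le_trans _ _ ((b' i - a' i)%:E * ((\prod_(i <- s) (b i - a i))%:E *
       mu (hbox (set_coords s a a') (set_coords s b b')))))%E.
  by rewrite lee_wpmul2l// ?lee_fin ?subr_ge0//; exact: IH.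
rewrite [leLHS]muleCA [leRHS]muleCA; apply: lee_wpmul2l; first exact: p0.
have set_coordsS (c c' : 'I_n -> R) :
    set_coords (i :: s) c c' = set_coord (set_coords s c c') i (c' i).
  by apply/funext => j; rewrite /set_coords /set_coord inE; case: eqP => [->|].
rewrite !set_coordsS.
have := @hbox_avg1 (set_coords s a a') (set_coords s b b') i (a' i) (b' i).
have set_coords_i (c c' : 'I_n -> R) : set_coords s c c' i = c i.
  by rewrite /set_coords (negbTE is_).
by rewrite !set_coords_i; apply.
Qed.

End log_concave_boxes.

Lemma le_poweR (R : realType) (r : R) (x y : \bar R) :
  0 <= r -> (0 <= x)%E -> (x <= y)%E -> (x `^ r <= y `^ r)%E.
Proof.
move=> r0 x0 xy; apply: gt0_ler_poweR => //; rewrite in_itv/= leey andbT//.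
exact: le_trans xy.
Qed.

(** * Weighted geometric means *)

Section geometric_mean.
Context (R : realType).
Implicit Types (l x y u v : R).

Definition gmean l x y := x `^ (1 - l) * y `^ l.

Lemma gmean_gt0 l x y : 0 < x -> 0 < y -> 0 < gmean l x y.
Proof. by move=> x0 y0; rewrite mulr_gt0 ?powR_gt0. Qed.

Lemma gmean_ge0 l x y : 0 <= gmean l x y.
Proof. by rewrite mulr_ge0 ?powR_ge0. Qed.

Lemma gmeanxx l x : 0 < x -> gmean l x x = x.
Proof.
move=> x0; rewrite /gmean -powRD ?subrK ?powRr1 ?ltW// gt_eqF//.
Qed.

Lemma gmeanM l x y u v : 0 <= x -> 0 <= y -> 0 <= u -> 0 <= v ->
  gmean l (x * u) (y * v) = gmean l x y * gmean l u v.
Proof. by move=> *; rewrite /gmean !powRM// mulrACA. Qed.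

Lemma gmean_prod (I : finType) l (F G : I -> R) : (forall i, 0 <= F i) ->
  (forall i, 0 <= G i) ->
  gmean l (\prod_i F i) (\prod_i G i) = \prod_i gmean l (F i) (G i).
Proof.
move=> F0 G0.
have powR_prod (H : I -> R) r : (forall i, 0 <= H i) ->
    (\prod_i H i) `^ r = \prod_i (H i) `^ r.
  move=> H0.
  suff [] : 0 <= \prod_i H i /\ (\prod_i H i) `^ r = \prod_i (H i) `^ r by [].
  elim/big_rec2 : _ => [|i y1 y2 _ [y0 <-]]; first by rewrite powR1.
  by rewrite mulr_ge0// powRM.
by rewrite /gmean !powR_prod// -big_split.
Qed.

Lemma le_gmean l x y u v : 0 <= l <= 1 -> 0 <= x <= u -> 0 <= y <= v ->
  gmean l x y <= gmean l u v.
Proof.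
move=> /andP[l0 l1] /andP[x0 xu] /andP[y0 yv].
have u0 := le_trans x0 xu; have v0 := le_trans y0 yv.
by apply: ler_pM; rewrite ?powR_ge0// ge0_ler_powR ?subr_ge0.
Qed.

(** Young's inequality for x^(1 - l) and y^l with the conjugate exponents 1 / (1 - l) and 1 / l. *)
Lemma gmean_le l x y : 0 < l < 1 -> 0 <= x -> 0 <= y ->
  gmean l x y <= (1 - l) * x + l * y.
Proof.
move=> /andP[l0 l1] x0 y0; have l1' : 0 < 1 - l by rewrite subr_gt0.
have := @conjugate_powR R (x `^ (1 - l)) (y `^ l) (1 - l)^-1 l^-1.
rewrite !powR_ge0 !invr_gt0 !invrK subrK => /(_ isT isT l1' l0 erefl).
by rewrite -!powRrM !divff ?gt_eqF// !powRr1// ![_ * x]mulrC ![_ * y]mulrC.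
Qed.

(** The arithmetic bound is applied to the shares x / (x + u), y / (y + v) and to their complements;
    shares and complements add up to 1. This superadditivity bounds the sides of a mean box from
    below. *)
Lemma gmeanD l x y u v : 0 < l < 1 -> 0 <= x -> 0 <= y -> 0 < u -> 0 < v ->
  gmean l x y + gmean l u v <= gmean l (x + u) (y + v).
Proof.
move=> l01 x0 y0 u0 v0.
have xu0 : 0 < x + u by rewrite ltr_wpDl.
have yv0 : 0 < y + v by rewrite ltr_wpDl.
have H p q : 0 <= p -> 0 <= q -> gmean l p q <=
    ((1 - l) * (p / (x + u)) + l * (q / (y + v))) * gmean l (x + u) (y + v).
  move=> p0 q0.
  have -> : gmean l p q = gmean l (p / (x + u)) (q / (y + v)) * gmean l (x + u) (y + v).
    by rewrite -gmeanM ?divr_ge0 ?(ltW xu0) ?(ltW yv0)// !divfK ?gt_eqF.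
  by rewrite ler_wpM2r ?gmean_ge0// gmean_le// divr_ge0// ?(ltW xu0) ?(ltW yv0).
apply: (le_trans (lerD (H _ _ x0 y0) (H _ _ (ltW u0) (ltW v0)))).
rewrite -mulrDl -[leRHS]mul1r ler_wpM2r ?gmean_ge0// addrACA -!mulrDr -!mulrDl.
by rewrite !divff ?gt_eqF// !mulr1 subrK.
Qed.

End geometric_mean.

Section geometric_boxes.
Context (R : realType) (n : nat) (mu : {measure set 'rV[R]_n -> \bar R}).
Implicit Types (a b : 'I_n -> R).
Hypothesis mu_flip : forall eps A, (forall i, eps i = -1 \/ eps i = 1) ->
  measurable A -> mu (flip eps @^-1` A) = mu A.
Hypothesis mu_lc : log_concave_measure mu.

Definition gbox (rho l : R) a b a' b' :=
  hbox (fun i => gmean l (a i) (a' i) / rho) (fun i => gmean l (b i) (b' i) / rho).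

(** Thickness is the ratio of the corners, hence invariant under dilation and uniform on a geometric
    grid. *)
Definition thin (rho : R) a b := forall i, 0 < a i < b i /\ b i <= rho * a i.

(* Log-concavity only controls arithmetic means, so both boxes are first shrunk,
   at their lower corners, to a common shape; the factor rho moves the geometric
   mean box below the arithmetic one, where the measure is denser. *)
Lemma hbox_gmean (rho l : R) a b a' b' : 1 <= rho -> 0 < l < 1 ->
  thin rho a b -> thin rho a' b' ->
  (mu (hbox a b) `^ (1 - l) * mu (hbox a' b') `^ l <=
   (rho ^+ n)%:E * mu (gbox rho l a b a' b'))%E.
Proof.
move=> rho1 l01 tab tab'; have /andP[l0 l1] := l01.
have l01' : 0 <= l <= 1 by rewrite !ltW.
have l1' : 0 < 1 - l by rewrite subr_gt0.
have rho0 : 0 < rho by rewrite (lt_le_trans ltr01).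
have a0 i : 0 < a i by have [/andP[]] := tab i.
have a'0 i : 0 < a' i by have [/andP[]] := tab' i.
have ab i : 0 < b i - a i by rewrite subr_gt0; have [/andP[]] := tab i.
have ab' i : 0 < b' i - a' i by rewrite subr_gt0; have [/andP[]] := tab' i.
(* Common side lengths: the arithmetic mean of two boxes with sides d is again a box with sides
   d. *)
pose d i := Num.min (b i - a i) (b' i - a' i).
have d0 i : 0 < d i by rewrite lt_min ab ab'.
pose c i := (1 - l) * a i + l * a' i.
pose g i := (gmean l (b i) (b' i) - gmean l (a i) (a' i)) / rho.
have gge i : gmean l (b i - a i) (b' i - a' i) <= rho * g i.
  rewrite /g mulrC divfK ?gt_eqF// lerBrDl.
  have := @gmeanD _ l (a i) (a' i) (b i - a i) (b' i - a' i) l01.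
  by rewrite !(addrC (_ i) (_ - _)) !subrK; apply; rewrite ?ltW.
have g0 i : 0 < g i.
  by rewrite -(pmulr_rgt0 _ rho0) (lt_le_trans _ (gge i))// gmean_gt0.
pose D := \prod_i d i; pose L := \prod_i (b i - a i).
pose L' := \prod_i (b' i - a' i); pose G := \prod_i g i.
have D0 : 0 < D by exact: prodr_gt0.
have L0 : 0 < L by exact: prodr_gt0.
have L'0 : 0 < L' by exact: prodr_gt0.
have G0 : 0 < G by exact: prodr_gt0.
pose Q := mu (hbox a b); pose Q' := mu (hbox a' b').
pose M := mu (hbox a (fun i => a i + d i)).
pose M' := mu (hbox a' (fun i => a' i + d i)).
pose N := mu (hbox c (fun i => c i + d i)).
have QM : (D%:E * Q <= L%:E * M)%E.
  have -> : D = \prod_i ((a i + d i) - a i).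
    by apply: eq_bigr => i _; rewrite addrC addKr.
  apply: hbox_avg => // i.
  - by rewrite (ltW (a0 i)) lexx.
  - by rewrite lerDl ltW.
  - by rewrite -subr_ge0 ltW.
  - by rewrite -lerBrDl ge_min lexx.
have QM' : (D%:E * Q' <= L'%:E * M')%E.
  have -> : D = \prod_i ((a' i + d i) - a' i).
    by apply: eq_bigr => i _; rewrite addrC addKr.
  apply: hbox_avg => // i.
  - by rewrite (ltW (a'0 i)) lexx.
  - by rewrite lerDl ltW.
  - by rewrite -subr_ge0 ltW.
  - by rewrite -lerBrDl ge_min lexx orbT.
have MN : (M `^ (1 - l) * M' `^ l <= N)%E.
  apply: (le_trans (hbox_log_concave mu_lc _ _ _ _ l01)).
  rewrite /N; set f := (X in hbox _ X); set f' := (X in (_ <= _ (hbox _ X))%E).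
  suff -> : f = f' by [].
  by apply/funext => i; rewrite /f /f' /c; ring.
have GN : (G%:E * N <= D%:E * mu (gbox rho l a b a' b'))%E.
  have -> : G = \prod_i (gmean l (b i) (b' i) / rho - gmean l (a i) (a' i) / rho).
    by apply: eq_bigr => i _; rewrite -mulrBl.
  have -> : D = \prod_i ((c i + d i) - c i).
    by apply: eq_bigr => i _; rewrite addrC addKr.
  have gc i : gmean l (a i) (a' i) <= c i by rewrite gmean_le// ltW.
  apply: hbox_avg => // i.
  - rewrite divr_ge0 ?gmean_ge0 ?(ltW rho0)//= ler_pdivrMr// (le_trans (gc i))//.
    by rewrite ler_peMr// (le_trans _ (gc i))// gmean_ge0.
  - by rewrite -subr_ge0 -mulrBl ltW// -/(g i).
  - by rewrite lerDl ltW.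
  (* Thinness enters here: the mean of the upper corners is at most rho times the mean of the lower
     ones, so after division by rho even the upper corner of [gbox] lies below [c]. *)
  - rewrite ler_pdivrMr// (@le_trans _ _ (c i * rho))//; last first.
      by rewrite ler_pM2r// lerDl ltW.
    rewrite (@le_trans _ _ (gmean l (rho * a i) (rho * a' i)))//.
      apply: le_gmean => //.
        by have [/andP[? /ltW ?] ->] := tab i; rewrite andbT (le_trans (ltW (a0 i))).
      by have [/andP[? /ltW ?] ->] := tab' i; rewrite andbT (le_trans (ltW (a'0 i))).
    by rewrite gmeanM ?gmeanxx ?(ltW rho0) ?(ltW (a0 i)) ?(ltW (a'0 i))// mulrC ler_pM2r.
(* The only loss: a side of [gbox] is at least 1 / rho times the geometric mean of the given sides,
   in each of n coordinates. *)
have LG : gmean l L L' <= rho ^+ n * G.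
  rewrite /L /L' gmean_prod => [|i|i]; [|exact: ltW..].
  rewrite -[n in rho ^+ n]card_ord -prodr_const /G -big_split/=.
  by apply: ler_prod => i _; rewrite gmean_ge0 gge.
have Q1 : (Q <= (L / D)%:E * M)%E.
  by rewrite mulrC EFinM -muleA lee_pdivlMl.
have Q'1 : (Q' <= (L' / D)%:E * M')%E.
  by rewrite mulrC EFinM -muleA lee_pdivlMl.
have : (Q `^ (1 - l) * Q' `^ l <= ((L / D)%:E * M) `^ (1 - l) * ((L' / D)%:E * M') `^ l)%E.
  by apply: lee_pmul; rewrite ?poweR_ge0//; apply: le_poweR;
    rewrite ?measure_ge0 ?(ltW l0) ?(ltW l1').
move/le_trans; apply.
rewrite !poweRM ?measure_ge0 ?lee_fin ?divr_ge0 ?(ltW D0) ?(ltW L0) ?(ltW L'0)//.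
rewrite muleACA !poweR_EFin -EFinM -/(gmean l (L / D) (L' / D)).
rewrite gmeanM ?invr_ge0 ?(ltW D0) ?(ltW L0) ?(ltW L'0)// gmeanxx ?invr_gt0//.
apply: (@le_trans _ _ ((gmean l L L' / D)%:E * N)%E).
  by rewrite lee_wpmul2l// lee_fin divr_ge0 ?gmean_ge0// ltW.
apply: (@le_trans _ _ ((rho ^+ n)%:E * ((G / D)%:E * N))%E).
  by rewrite muleA -EFinM lee_wpmul2r ?measure_ge0// lee_fin mulrA ler_pM2r ?invr_gt0.
rewrite lee_wpmul2l ?lee_fin ?exprn_ge0 ?(ltW rho0)//.
by rewrite mulrC EFinM -muleA lee_pdivrMl.
Qed.

End geometric_boxes.

(** * The Hadwiger-Ohmann argument *)

Section monotone_limits.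
Context d (T : measurableType d) (R : realType) (mu : {measure set T -> \bar R}).

Lemma measure_bigcup_le (F : (set T)^nat) (c : \bar R) :
  (forall k, measurable (F k)) -> nondecreasing_seq F ->
  (forall k, (mu (F k) <= c)%E) -> (mu (\bigcup_k F k) <= c)%E.
Proof.
move=> mF ndF Fc; have mUF := bigcupT_measurable F mF.
apply: (cvge_to_le (nondecreasing_cvg_mu mF mUF ndF)).
exact: nearW.
Qed.

Lemma measure_bigcap_ge (F : (set T)^nat) (c : \bar R) :
  (forall k, measurable (F k)) -> (mu (F 0%N) < +oo)%E ->
  nonincreasing_seq F -> (forall k, (c <= mu (F k))%E) ->
  (c <= mu (\bigcap_k F k))%E.
Proof.
move=> mF F0 niF Fc; have mIF := bigcapT_measurable mF.
apply: (cvge_to_ge (nonincreasing_cvg_mu F0 mF mIF niF)).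
exact: nearW.
Qed.

End monotone_limits.

(** Intermediate value theorem for the mass of E below x_i = t as a function of t. It is
    left-continuous by continuity from below, and right-continuous because E has finite mass and
    hyperplanes are null. The supremum of the t where the mass is at most q works. *)
Lemma halfspace_split (R : realType) n (mu : {measure set 'rV[R]_n -> \bar R})
  (i : 'I_n) (E : set 'rV[R]_n) (q : R) : measurable E -> (mu E < +oo)%E ->
  (forall c, mu (hyperplane i c) = 0%E) -> 0 < q -> (q%:E < mu E)%E ->
  exists t, mu (E `&` halfspace i t) = q%:E.
Proof.
move=> mE Eoo hyp0 q0 qE.
pose H t := E `&` halfspace i t.
have mH t : measurable (H t).
  by apply: measurableI => //; exact: measurable_halfspace.
have subH s t : s <= t -> H s `<=` H t.
  by move=> st x [Ex xs]; split=> //; exact: lt_le_trans st.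
have leH s t : s <= t -> (mu (H s) <= mu (H t))%E.
  by move=> st; apply: le_measure; rewrite ?inE//; exact: subH.
have Hoo t : (mu (H t) < +oo)%E.
  apply: le_lt_trans Eoo; apply: le_measure; rewrite ?inE//.
  exact: subIsetl.
pose S := [set t | (mu (H t) <= q%:E)%E].
have S_up t s : S t -> s <= t -> S s by move=> St st; exact: le_trans (leH _ _ st) St.
have hS : has_sup S.
  split.
    apply: contrapT => /forallNP noS.
    have : (q%:E <= mu (\bigcap_k H (- k%:R)%R))%E.
      apply: measure_bigcap_ge => //.
        by move=> j k jk; apply/subsetPset/subH; rewrite lerN2 ler_nat.
      by move=> k; have := noS (- k%:R) => /negP; rewrite -ltNge => /ltW.
    rewrite (_ : \bigcap_k _ = set0) ?measure0 ?lee_fin; last first.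
      apply/seteqP; split=> x // Hx.
      have [_] := Hx (Num.trunc `|x ord0 i|).+1 I.
      rewrite /halfspace/= ltrNr => xk.
      by have := lt_trans (truncnS_gt _) xk; rewrite ltNge -normrN ler_norm.
    by rewrite leNgt q0.
  apply: contrapT => noub.
  have : (mu (\bigcup_k H k%:R%R) <= q%:E)%E.
    apply: measure_bigcup_le => //.
      by move=> j k jk; apply/subsetPset/subH; rewrite ler_nat.
    move=> k; apply: contrapT => nk; apply: noub; exists k%:R => t St.
    by rewrite leNgt; apply/negP => /ltW/(S_up _ _ St).
  rewrite (_ : \bigcup_k _ = E); first by rewrite leNgt qE.
  apply/seteqP; split=> [x [k _ []]//|x Ex].
  exists (Num.trunc (x ord0 i)).+1 => //; split=> //.
  exact: truncnS_gt.
pose t0 := sup S; exists t0; apply/eqP; rewrite eq_le; apply/andP; split.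
  have HE : \bigcup_k H (t0 - k.+1%:R^-1) = H t0.
    apply/seteqP; split=> [x [k _]|x [Ex xt]].
      by apply: subH; rewrite gerBl.
    have [k] := ltr_add_invr xt; rewrite -ltrBrDr => xk.
    by exists k => //; split.
  rewrite -/(H t0) -HE; apply: measure_bigcup_le => //.
    move=> j k jk; apply/subsetPset/subH.
    by rewrite lerD2l lerN2 lef_pV2 ?posrE// ler_nat.
  move=> k; have [|s Ss ts] := @sup_adherent _ S k.+1%:R^-1 _ hS => //.
  exact: (S_up _ _ Ss (ltW ts)).
apply: (@le_trans _ _ (mu (H t0 `|` hyperplane i t0))); last first.
  apply: (@le_trans _ _ (mu (H t0) + mu (hyperplane i t0)))%E.
    by apply: measureU2 => //; exact: measurable_hyperplane.
  by rewrite hyp0 adde0.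
apply: (@le_trans _ _ (mu (\bigcap_k H (t0 + k.+1%:R^-1)%R))); last first.
  apply: le_measure; rewrite ?inE.
  - exact: bigcapT_measurable.
  - by apply: measurableU => //; exact: measurable_hyperplane.
  move=> x Hx; have [Ex _] := Hx 0%N I.
  have : x ord0 i <= t0.
    rewrite leNgt; apply/negP => /ltr_add_invr[k tk].
    by have [_ /lt_trans/(_ tk)] := Hx k I; rewrite ltxx.
  by rewrite le_eqVlt => /predU1P[|]; [right|left].
apply: measure_bigcap_ge => //.
  move=> j k jk; apply/subsetPset/subH.
  by rewrite lerD2l lef_pV2 ?posrE// ler_nat.
move=> k; rewrite leNgt; apply/negP => /ltW Sk.
have := ub_le_sup hS.2 Sk; rewrite -/t0 leNgt ltrDl invr_gt0.
by rewrite ltr0n.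
Qed.

Section hadwiger_ohmann.
Context (R : realType) (n : nat).

(* Lower and upper corner of a half-open box. *)
Definition corners := ({ffun 'I_n -> R} * {ffun 'I_n -> R})%type.
Implicit Types (Q : corners) (s X Y : seq corners) (i : 'I_n).

Definition box_union s : set 'rV[R]_n := \bigcup_(Q in [set` s]) hbox Q.1 Q.2.

(** Disjointness is stated through a separating coordinate, which provides the direction of the
    cutting hyperplane. *)
Definition separated s := pairwise
  (fun Q Q' => [exists i, (Q.2 i <= Q'.1 i) || (Q'.2 i <= Q.1 i)]) s.

Definition all_thin (rho : R) s := forall Q, Q \in s -> thin rho Q.1 Q.2.

Lemma measurable_box_union s : measurable (box_union s).
Proof.
rewrite /box_union bigcup_seq; apply: bigsetU_measurable => Q _.
exact: measurable_hbox.
Qed.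

Definition cut_lo i (t : R) Q : corners :=
  (Q.1, [ffun j => if j == i then Num.min (Q.2 i) t else Q.2 j]).

Definition cut_hi i (t : R) Q : corners :=
  ([ffun j => if j == i then Num.max (Q.1 i) t else Q.1 j], Q.2).

(** Boxes missing the half-space are discarded instead of being kept as empty ones: this preserves
    thinness and makes the number of boxes drop. *)
Definition cuts_lo i (t : R) s := [seq cut_lo i t Q | Q <- s & Q.1 i < t].

Definition cuts_hi i (t : R) s := [seq cut_hi i t Q | Q <- s & t < Q.2 i].

Lemma cuts_loE i t s : box_union (cuts_lo i t s) = box_union s `&` halfspace i t.
Proof.
apply/seteqP; split=> x.
  move=> [_ /= /mapP[Q + ->] /hboxP/= xQ]; rewrite mem_filter => /andP[_ Qs].
  split; first exists Q => //; first apply/hboxP => j.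
    have /andP[-> /=] := xQ j; rewrite ffunE.
    by case: eqP => // ->; rewrite lt_min => /andP[].
  by have /andP[_] := xQ i; rewrite ffunE eqxx lt_min => /andP[].
move=> [[Q /= Qs /hboxP xQ] xt]; exists (cut_lo i t Q).
  apply/mapP; exists Q => //; rewrite mem_filter Qs andbT.
  by have /andP[/le_lt_trans + _] := xQ i; apply.
apply/hboxP => j; have /andP[-> /=] := xQ j; rewrite ffunE.
by case: eqP => // -> xb; rewrite lt_min xb.
Qed.

Lemma cuts_hiE i t s : box_union (cuts_hi i t s) = box_union s `\` halfspace i t.
Proof.
apply/seteqP; split=> x.
  move=> [_ /= /mapP[Q + ->] /hboxP/= xQ]; rewrite mem_filter => /andP[_ Qs].
  split; first exists Q => //; first apply/hboxP => j.
    have /andP[+ -> /=] := xQ j; rewrite andbT ffunE.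
    by case: eqP => // ->; rewrite ge_max => /andP[].
  have /andP[+ _] := xQ i; rewrite ffunE eqxx ge_max => /andP[_].
  by rewrite /halfspace/= leNgt => /negP.
move=> [[Q /= Qs /hboxP xQ] /negP]; rewrite -leNgt => tx; exists (cut_hi i t Q).
  apply/mapP; exists Q => //; rewrite mem_filter Qs andbT.
  by have /andP[_ +] := xQ i; exact: le_lt_trans.
apply/hboxP => j; have /andP[+ -> /=] := xQ j; rewrite andbT ffunE.
by case: eqP => // -> xb; rewrite ge_max xb.
Qed.

Lemma all_thin_lo rho i t s : all_thin rho s -> all_thin rho (cuts_lo i t s).
Proof.
move=> ts _ /mapP[Q + ->]; rewrite mem_filter => /andP[Qt Qs] j /=.
rewrite ffunE; have [/andP[-> Q12] Qrho] := ts _ Qs j.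
case: eqP => [ji|//]; rewrite ji in Q12 Qrho *.
by rewrite lt_min Q12 Qt ge_min Qrho.
Qed.

Lemma all_thin_hi rho i t s : 0 <= rho -> all_thin rho s -> all_thin rho (cuts_hi i t s).
Proof.
move=> rho0 ts _ /mapP[Q + ->]; rewrite mem_filter => /andP[Qt Qs] j /=.
rewrite ffunE; have [/andP[Q0 Q12] Qrho] := ts _ Qs j.
case: eqP => [ji|_]; last by rewrite Q0 Q12.
rewrite ji in Q0 Q12 Qrho *.
by rewrite lt_max gt_max Q0 Q12 Qt (le_trans Qrho)// ler_wpM2l// le_max lexx.
Qed.

Let subpairwise_map (P : pred corners) (f : corners -> corners) s :
  (forall Q i, Q.1 i <= (f Q).1 i /\ (f Q).2 i <= Q.2 i) ->
  separated s -> separated [seq f Q | Q <- s & P Q].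
Proof.
move=> sub seps; rewrite /separated pairwise_map.
have := pairwise_filter P seps; apply: sub_pairwise => Q Q' /existsP[j QQ'].
apply/existsP; exists j; have [? ?] := sub Q j; have [? ?] := sub Q' j.
case/orP: QQ' => QQ'; apply/orP; [left|right].
  exact/(le_trans _ (le_trans QQ' _)).
exact/(le_trans _ (le_trans QQ' _)).
Qed.

Lemma separated_lo i t s : separated s -> separated (cuts_lo i t s).
Proof.
apply: subpairwise_map => Q j /=; split=> //; rewrite ffunE.
by case: eqP => // ->; rewrite ge_min lexx.
Qed.

Lemma separated_hi i t s : separated s -> separated (cuts_hi i t s).
Proof.
apply: subpairwise_map => Q j /=; split=> //; rewrite ffunE.
by case: eqP => // ->; rewrite le_max lexx.
Qed.

Lemma size_lo i t s : (size (cuts_lo i t s) <= size s)%N.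
Proof. by rewrite size_map size_filter count_size. Qed.

Lemma size_hi i t s : (size (cuts_hi i t s) <= size s)%N.
Proof. by rewrite size_map size_filter count_size. Qed.

Let count_lt (P : pred corners) Q s : Q \in s -> ~~ P Q -> (count P s < size s)%N.
Proof.
move=> Qs PQ; rewrite ltn_neqAle count_size andbT -all_count.
by apply/negP => /allP/(_ _ Qs); rewrite (negbTE PQ).
Qed.

Lemma size_lo_lt i t s Q : Q \in s -> t <= Q.1 i ->
  (size (cuts_lo i t s) < size s)%N.
Proof.
move=> Qs tQ; rewrite size_map size_filter (count_lt Qs)//.
by rewrite -leNgt.
Qed.

Lemma size_hi_lt i t s Q : Q \in s -> Q.2 i <= t ->
  (size (cuts_hi i t s) < size s)%N.
Proof.
move=> Qs tQ; rewrite size_map size_filter (count_lt Qs)//.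
by rewrite -leNgt.
Qed.

Variable mu : {measure set 'rV[R]_n -> \bar R}.
Hypothesis mu_flip : forall eps A, (forall i, eps i = -1 \/ eps i = 1) ->
  measurable A -> mu (flip eps @^-1` A) = mu A.
Hypothesis mu_lc : log_concave_measure mu.
Hypothesis mu_hyp : forall i c, mu (hyperplane i c) = 0%E.
Variable rho : R.
Hypothesis rho1 : 1 <= rho.

Let rho0 : 0 < rho. Proof. exact: lt_le_trans rho1. Qed.

Definition admissible s :=
  [/\ all_thin rho s, separated s & (mu (box_union s) < +oo)%E].

(** [Z] is any set containing the mean boxes of all pairs, so that the condition passes to the
    halves when all three sets are cut. *)
Definition gmean_covered (l : R) X Y (Z : set 'rV[R]_n) :=
  forall Q Q', Q \in X -> Q' \in Y -> gbox rho l Q.1 Q.2 Q'.1 Q'.2 `<=` Z.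

Definition gmean_ineq (l : R) X Y (Z : set 'rV[R]_n) :=
  (mu (box_union X) `^ (1 - l) * mu (box_union Y) `^ l <= (rho ^+ n)%:E * mu Z)%E.

Let mu_lo i t s : (mu (box_union (cuts_lo i t s)) <= mu (box_union s))%E.
Proof.
rewrite cuts_loE; apply: le_measure; rewrite ?inE; last exact: subIsetl.
- by apply: measurableI; [exact: measurable_box_union|exact: measurable_halfspace].
- exact: measurable_box_union.
Qed.

Let mu_hi i t s : (mu (box_union (cuts_hi i t s)) <= mu (box_union s))%E.
Proof.
rewrite cuts_hiE; apply: le_measure; rewrite ?inE; last exact: subDsetl.
- by apply: measurableD; [exact: measurable_box_union|exact: measurable_halfspace].
- exact: measurable_box_union.
Qed.

Let mu_cut i t (E : set 'rV[R]_n) : measurable E ->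
  mu E = (mu (E `&` halfspace i t) + mu (E `\` halfspace i t))%E.
Proof.
by move=> mE; rewrite addeC -measureDI//; exact: measurable_halfspace.
Qed.

Lemma admissible_lo i t s : admissible s -> admissible (cuts_lo i t s).
Proof.
by move=> [? ? soo]; split;
  [exact: all_thin_lo|exact: separated_lo|exact: le_lt_trans soo].
Qed.

Lemma admissible_hi i t s : admissible s -> admissible (cuts_hi i t s).
Proof.
by move=> [? ? soo]; split;
  [apply: all_thin_hi => //; exact: ltW|exact: separated_hi|exact: le_lt_trans soo].
Qed.

Let mem_lo i t s P : P \in cuts_lo i t s ->
  exists2 Q, Q \in s & Q.1 i < t /\ P = cut_lo i t Q.
Proof.
by move=> /mapP[Q + ->]; rewrite mem_filter => /andP[Qt Qs]; exists Q.
Qed.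

Let mem_hi i t s P : P \in cuts_hi i t s ->
  exists2 Q, Q \in s & t < Q.2 i /\ P = cut_hi i t Q.
Proof.
by move=> /mapP[Q + ->]; rewrite mem_filter => /andP[Qt Qs]; exists Q.
Qed.

Let shrunk (Q P : corners) := forall j, 0 <= Q.1 j <= P.1 j /\ 0 <= P.2 j <= Q.2 j.

Let shrunkxx Q : thin rho Q.1 Q.2 -> shrunk Q Q.
Proof.
move=> tQ j; have [/andP[Q0 Q12] _] := tQ j.
by rewrite !lexx (ltW Q0) (ltW (lt_trans Q0 Q12)).
Qed.

Let shrunk_lo i t Q : 0 < t -> thin rho Q.1 Q.2 -> shrunk Q (cut_lo i t Q).
Proof.
move=> t0 tQ j; rewrite ffunE; have [/andP[/ltW Q0 /(le_lt_trans Q0)/ltW Q12] _] := tQ j.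
rewrite Q0 lexx; case: eqP => [<-|_]; last by rewrite lexx Q12.
by rewrite le_min ge_min lexx Q12 ltW.
Qed.

Let shrunk_hi i t Q : thin rho Q.1 Q.2 -> shrunk Q (cut_hi i t Q).
Proof.
move=> tQ j; rewrite ffunE; have [/andP[/ltW Q0 /(le_lt_trans Q0)/ltW Q12] _] := tQ j.
rewrite Q0 Q12 lexx; case: eqP => [<-|_]; last by rewrite lexx.
by rewrite le_max lexx.
Qed.

Let gbox_sub l (Q P Q' P' : corners) : 0 < l < 1 -> shrunk Q P -> shrunk Q' P' ->
  gbox rho l P.1 P.2 P'.1 P'.2 `<=` gbox rho l Q.1 Q.2 Q'.1 Q'.2.
Proof.
move=> /andP[/ltW l0 /ltW l1] QP QP' x /hboxP xP; apply/hboxP => j.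
have l01 : 0 <= l <= 1 by rewrite l0.
have [Q1 Q2] := QP j; have [Q'1 Q'2] := QP' j; have /andP[x1 x2] := xP j.
apply/andP; split.
  by apply: le_trans x1; rewrite ler_pM2r ?invr_gt0//; exact: le_gmean.
by apply: (lt_le_trans x2); rewrite ler_pM2r ?invr_gt0//; exact: le_gmean.
Qed.

(** By monotonicity of the geometric mean, the hyperplane at [gmean l t t' / rho] separates the mean
    boxes of lower pieces from those of upper pieces; only like halves are paired. *)
Let gmean_covered_lo l i t t' X Y Z : 0 < l < 1 -> 0 < t -> 0 < t' ->
  all_thin rho X -> all_thin rho Y -> gmean_covered l X Y Z ->
  gmean_covered l (cuts_lo i t X) (cuts_lo i t' Y) (Z `&` halfspace i (gmean l t t' / rho)).
Proof.
move=> l01 t0 t'0 tX tY XYZ _ _ /mem_lo[Q QX [_ ->]] /mem_lo[Q' Q'Y [_ ->]] x xQ.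
split.
  apply: (XYZ _ _ QX Q'Y); apply: gbox_sub xQ => //; apply: shrunk_lo => //.
    exact: tX.
  exact: tY.
move/hboxP : xQ => /(_ i)/andP[_ /lt_le_trans]; apply.
rewrite !ffunE eqxx ler_pM2r ?invr_gt0//.
have [/andP[Q0 /(lt_trans Q0) /ltW Q20] _] := tX _ QX i.
have [/andP[Q'0 /(lt_trans Q'0) /ltW Q'20] _] := tY _ Q'Y i.
have /andP[/ltW l0 /ltW l1] := l01.
by apply: le_gmean; rewrite ?l0// ge_min lexx orbT le_min ?Q20 ?Q'20 ltW.
Qed.

Let gmean_covered_hi l i t t' X Y Z : 0 < l < 1 -> 0 < t -> 0 < t' ->
  all_thin rho X -> all_thin rho Y -> gmean_covered l X Y Z ->
  gmean_covered l (cuts_hi i t X) (cuts_hi i t' Y) (Z `\` halfspace i (gmean l t t' / rho)).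
Proof.
move=> l01 t0 t'0 tX tY XYZ _ _ /mem_hi[Q QX [_ ->]] /mem_hi[Q' Q'Y [_ ->]] x xQ.
split.
  apply: (XYZ _ _ QX Q'Y); apply: gbox_sub xQ => //; apply: shrunk_hi => //.
    exact: tX.
  exact: tY.
apply/negP; rewrite -leNgt; move/hboxP : xQ => /(_ i)/andP[+ _].
apply: le_trans; rewrite !ffunE eqxx ler_pM2r ?invr_gt0//.
have /andP[/ltW l0 /ltW l1] := l01.
by apply: le_gmean; rewrite ?l0// le_max lexx orbT ltW.
Qed.

(** The cut at the lower face of Q2 drops Q2 from the lower half of X and Q1 from the upper half, so
    both halves have fewer boxes than X, while those of Y have no more than Y. With the same
    proportion p in X and Y, homogeneity of the geometric mean makes the two inductive bounds add up
    with weights p and 1 - p. *)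
Let gmean_ineq_cut l X Y Z Q1 Q2 i : 0 < l < 1 -> admissible X -> admissible Y ->
  measurable Z -> gmean_covered l X Y Z -> Q1 \in X -> Q2 \in X -> Q1.2 i <= Q2.1 i ->
  (forall X' Y' Z', (size X' < size X)%N -> (size Y' <= size Y)%N ->
    admissible X' -> admissible Y' -> measurable Z' -> gmean_covered l X' Y' Z' ->
    gmean_ineq l X' Y' Z') ->
  gmean_ineq l X Y Z.
Proof.
move=> l01 aX aY mZ XYZ Q1X Q2X Q12 IH; have /andP[l0 l1] := l01.
have l1' : 0 < 1 - l by rewrite subr_gt0.
set t := Q2.1 i in Q12.
have [tX _ Xoo] := aX; have [tY _ Yoo] := aY.
have t0 : 0 < t by have [/andP[]] := tX _ Q2X i.
have lo_lt : (size (cuts_lo i t X) < size X)%N by exact: size_lo_lt Q2X _.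
have hi_lt : (size (cuts_hi i t X) < size X)%N by exact: size_hi_lt Q1X _.
have mX := measurable_box_union X; have mY := measurable_box_union Y.
have XE := mu_cut i t mX; rewrite -cuts_loE -cuts_hiE in XE.
have aXlo := admissible_lo i t aX; have aXhi := admissible_hi i t aX.
(* If one half of X is null, the other carries all the mass and Y is left uncut. *)
have [Xlo0|Xlo_neq0] := eqVneq (mu (box_union (cuts_lo i t X))) 0%E.
  rewrite Xlo0 add0e in XE; rewrite /gmean_ineq XE.
  apply: IH => // Q Q' /mem_hi[P PX [_ ->]] Q'Y x xg.
  apply: (XYZ _ _ PX Q'Y); apply: gbox_sub xg => //.
    exact/shrunk_hi/tX.
  exact/shrunkxx/tY.
have [Xhi0|Xhi_neq0] := eqVneq (mu (box_union (cuts_hi i t X))) 0%E.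
  rewrite Xhi0 adde0 in XE; rewrite /gmean_ineq XE.
  apply: IH => // Q Q' /mem_lo[P PX [_ ->]] Q'Y x xg.
  apply: (XYZ _ _ PX Q'Y); apply: gbox_sub xg => //.
    exact/(shrunk_lo _ t0)/tX.
  exact/shrunkxx/tY.
have [Y0|Y_neq0] := eqVneq (mu (box_union Y)) 0%E.
  by rewrite /gmean_ineq Y0 poweR0r ?gt_eqF// mule0 mule_ge0// lee_fin exprn_ge0// ltW.
have fin (E : set 'rV[R]_n) : (mu E < +oo)%E -> mu E != 0%E ->
    exists2 e : R, 0 < e & mu E = e%:E.
  move=> Eoo E0; exists (fine (mu E)).
    by rewrite fine_gt0// Eoo lt0e E0 measure_ge0.
  by rewrite fineK// ge0_fin_numE.
have [xlo xlo0 Xlo] := fin _ (le_lt_trans (mu_lo i t X) Xoo) Xlo_neq0.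
have [xhi xhi0 Xhi] := fin _ (le_lt_trans (mu_hi i t X) Xoo) Xhi_neq0.
have [y y0 YE] := fin _ Yoo Y_neq0.
rewrite Xlo Xhi -EFinD in XE.
set x := xlo + xhi in XE.
have x0 : 0 < x by rewrite addr_gt0.
pose p := xlo / x; have p0 : 0 < p by rewrite divr_gt0.
have p1 : 0 < 1 - p by rewrite subr_gt0 ltr_pdivrMr// mul1r ltrDl.
have py : 0 < p * y by rewrite mulr_gt0.
have [|t' Yt'] := @halfspace_split _ _ mu i (box_union Y) (p * y) mY Yoo (mu_hyp i) py.
  by rewrite YE lte_fin gtr_pMl// -subr_gt0.
(* Y lies in the open orthant, so a hyperplane with positive mass below it sits at a positive
   coordinate. *)
have t'0 : 0 < t'.
  rewrite ltNge; apply/negP => t'0; move: Yt'.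
  rewrite (_ : _ `&` _ = set0) ?measure0.
    by move=> [] /esym/eqP; rewrite gt_eqF.
  apply/seteqP; split=> z // [[Q /= QY /hboxP/(_ i)/andP[Qz _]]].
  rewrite /halfspace/= ltNge => /negP; apply; apply: (le_trans t'0).
  by have [/andP[/ltW/le_trans + _] _] := tY _ QY i; apply.
rewrite -cuts_loE in Yt'.
have Yhi : mu (box_union (cuts_hi i t' Y)) = ((1 - p) * y)%:E.
  have := mu_cut i t' mY; rewrite -cuts_loE -cuts_hiE Yt' YE.
  case: (mu _) => [h| |]//=; rewrite -EFinD => -[yE]; congr (_%:E).
  by rewrite [in RHS]mulrBl mul1r [in X in X - _]yE addrC addKr.
set w := gmean l t t' / rho.
have mw := @measurable_halfspace _ n i w.
have IHlo := IH _ _ (Z `&` halfspace i w) lo_lt (size_lo i t' Y) aXlo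
  (admissible_lo i t' aY) (measurableI _ _ mZ mw) (gmean_covered_lo l01 t0 t'0 tX tY XYZ).
have IHhi := IH _ _ (Z `\` halfspace i w) hi_lt (size_hi i t' Y) aXhi
  (admissible_hi i t' aY) (measurableD mZ mw) (gmean_covered_hi l01 t0 t'0 tX tY XYZ).
have xloE : xlo = p * x by rewrite /p divfK ?gt_eqF.
have xhiE : xhi = (1 - p) * x by rewrite mulrBl mul1r -xloE /x addrC addKr.
clearbody p x w; move: IHlo IHhi; rewrite /gmean_ineq Xlo Xhi Yt' Yhi xloE xhiE XE YE.
rewrite !poweR_EFin -!EFinM.
rewrite -!/(gmean _ _ _) !gmeanM ?(ltW p0) ?(ltW p1) ?(ltW x0) ?(ltW y0)//.
rewrite !gmeanxx// => IHlo IHhi.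
rewrite (mu_cut i w mZ) ge0_muleDr//; apply: le_trans (leeD IHlo IHhi).
by rewrite -EFinD lee_fin -mulrDl addrC subrK mul1r.
Qed.

Let gmean_coveredC l X Y Z : gmean_covered l X Y Z -> gmean_covered (1 - l) Y X Z.
Proof.
move=> XYZ Q Q' QY Q'X x /hboxP xQ; apply: (XYZ _ _ Q'X QY); apply/hboxP => j.
by have := xQ j; rewrite /gmean opprB addrC subrK ![_ `^ (1 - l) * _]mulrC.
Qed.

Let gmean_ineqC l X Y Z : gmean_ineq (1 - l) Y X Z -> gmean_ineq l X Y Z.
Proof. by rewrite /gmean_ineq opprB addrC subrK muleC. Qed.

Let box_union0 : mu (box_union [::]) = 0%E.
Proof. by rewrite /box_union set_nil bigcup_set0 measure0. Qed.

Let admissible_split Q1 Q2 s : admissible [:: Q1, Q2 & s] ->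
  exists i P1 P2, [/\ P1 \in [:: Q1, Q2 & s], P2 \in [:: Q1, Q2 & s] &
    P1.2 i <= P2.1 i].
Proof.
move=> [_ /= /andP[/andP[/existsP[i +] _] _] _].
by move=> /orP[] Q12; exists i; [exists Q1, Q2|exists Q2, Q1];
  rewrite !inE !eqxx ?orbT.
Qed.

(* The equal-proportion cut of Hadwiger and Ohmann: cut X between two of its
   boxes, and Y by a parallel hyperplane in the same proportion of mass. *)
Lemma hadwiger_ohmann l X Y Z : 0 < l < 1 -> admissible X -> admissible Y ->
  measurable Z -> gmean_covered l X Y Z -> gmean_ineq l X Y Z.
Proof.
have [N] := ubnP (size X + size Y); elim: N l X Y Z => // N IH l X Y Z.
rewrite ltnS => XYN l01 aX aY mZ XYZ; have /andP[l0 l1] := l01.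
have RHS0 : (0 <= (rho ^+ n)%:E * mu Z)%E.
  by rewrite mule_ge0// lee_fin exprn_ge0// ltW.
case: X XYN aX XYZ => [|Q1 [|Q2 X]] XYN aX XYZ.
- by rewrite /gmean_ineq box_union0 poweR0r ?mul0e// gt_eqF// subr_gt0.
- case: Y XYN aY XYZ => [|Q1' [|Q2' Y]] XYN aY XYZ.
  + by rewrite /gmean_ineq box_union0 poweR0r ?mule0// gt_eqF.
  + have := XYZ Q1 Q1'; rewrite !mem_head => /(_ isT isT) QZ.
    have box_union1 Q : box_union [:: Q] = hbox Q.1 Q.2.
      by rewrite /box_union set_cons1 bigcup_set1.
    rewrite /gmean_ineq !box_union1.
    have [tX _ _] := aX; have [tY _ _] := aY.
    apply: (le_trans (hbox_gmean mu_flip mu_lc rho1 l01 _ _)).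
    * by apply: tX; rewrite mem_head.
    * by apply: tY; rewrite mem_head.
    * rewrite lee_wpmul2l ?lee_fin ?exprn_ge0 ?(ltW rho0)//.
      by apply: le_measure; rewrite ?inE//; exact: measurable_hbox.
  (* X is a single box: exchange X with Y and l with 1 - l, so that the family to be cut has two
     boxes. *)
  + have [i [P1 [P2 [P1Y P2Y P12]]]] := admissible_split aY.
    apply: gmean_ineqC; apply: (@gmean_ineq_cut _ _ _ _ P1 P2 i) => //.
    * by rewrite subr_gt0 l1 gtrBl.
    * exact: gmean_coveredC.
    * move=> X' Y' Z' X'lt Y'le aX' aY' mZ' XYZ'; apply: IH => //.
        by apply: leq_trans XYN; rewrite [leqRHS]addnC -addSn leq_add.
      by rewrite subr_gt0 l1 gtrBl.
- have [i [P1 [P2 [P1Y P2Y P12]]]] := admissible_split aX.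
  apply: (@gmean_ineq_cut _ _ _ _ P1 P2 i) => //.
  move=> X' Y' Z' X'lt Y'le aX' aY' mZ' XYZ'; apply: IH => //.
  by rewrite (leq_trans _ XYN)// -addSn leq_add.
Qed.

End hadwiger_ohmann.

(** * Dilations of unconditional convex sets *)

Section unconditional_convex.
Context (R : realType) (n : nat).
Implicit Types (A S : set 'rV[R]_n) (x y : 'rV[R]_n).

Definition solid A := forall x y, A x ->
  (forall i, `|y ord0 i| <= `|x ord0 i|) -> A y.

Lemma convex_setE A x y (l : R) : convex_set A -> A x -> A y -> 0 <= l <= 1 ->
  A ((1 - l) *: x + l *: y).
Proof.
move=> cA Ax Ay /andP[l0 l1].
have := cA y x (Itv01 l0 l1); rewrite !inE => /(_ Ay Ax).
by rewrite addrC.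
Qed.

Lemma unconditional_setE A eps x : unconditional_set A ->
  (forall i, eps i = -1 \/ eps i = 1) -> A x -> A (flip eps x).
Proof.
move=> uA eps1 Ax; have := uA x eps eps1; rewrite !indicE (mem_set Ax) => /eqP.
by rewrite pnatr_eq1 eqb1 inE.
Qed.

(** Coordinates are changed one at a time: r z_i with |r| <= 1 is a convex combination of z_i and
    its mirror image. *)
Lemma unconditional_convex_solid A :
  unconditional_set A -> convex_set A -> solid A.
Proof.
move=> uA cA x y Ax yx.
suff : forall s : seq 'I_n,
    A (\row_j (if j \in s then y ord0 j else x ord0 j)).
  move=> /(_ (index_enum _)); congr A.
  by apply/rowP => j; rewrite mxE mem_index_enum.
elim=> [|i s IH].
  by move: Ax; congr A; apply/rowP => j; rewrite mxE.
set z := \row_j _ in IH.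
have yz : `|y ord0 i| <= `|z ord0 i| by rewrite mxE; case: ifP.
have [z0|z0] := eqVneq (z ord0 i) 0.
  move: IH; congr A; apply/rowP => j; rewrite [RHS]mxE inE.
  have [->/=|ji] := eqVneq j i; last by rewrite mxE.
  by move: yz; rewrite z0 normr0 normr_le0 => /eqP.
pose eps j : R := if j == i then -1 else 1.
have eps1 j : eps j = -1 \/ eps j = 1 by rewrite /eps; case: eqP; [left|right].
pose r := y ord0 i / z ord0 i.
have : `|r| <= 1 by rewrite normf_div ler_pdivrMr ?normr_gt0// mul1r.
rewrite ler_norml => /andP[r1 r2].
(* The mirror image has weight w = (1 - r) / 2, because (1 - w) - w = r. *)
have := @convex_setE _ _ _ ((1 - r) / 2) cA IH (unconditional_setE uA eps1 IH).
have -> : 0 <= (1 - r) / 2 <= 1 by lra.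
move=> /(_ isT); congr A; apply/rowP => j; rewrite !mxE inE /eps.
have [->/=|ji] := eqVneq j i; last first.
  by rewrite mul1r -mulrDl subrK mul1r.
set zi := (if _ then _ else _); have zE : zi = z ord0 i by rewrite mxE.
have -> : y ord0 i = r * zi by rewrite zE /r divfK.
by field.
Qed.

End unconditional_convex.

(** * Geometric grids inside a solid set *)

Section grid.
Context (R : realType) (n : nat) (h : R) (S : set 'rV[R]_n).
Hypothesis h0 : 0 < h.
Hypothesis solidS : solid S.

(** Indices are shifted by N, so that natural numbers encode the exponents -N, ..., N - 1 of
    [expR h]; [e] is 0 at the lower corner and 1 at the upper one. *)
Let grid_corner N (k : {ffun 'I_n -> 'I_(N + N)}) (e : nat) : {ffun 'I_n -> R} :=
  [ffun i => expR (((k i + e)%:R - N%:R) * h)].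

Let grid_box N (k : {ffun 'I_n -> 'I_(N + N)}) : corners R n :=
  (grid_corner k 0, grid_corner k 1).

(** Membership is tested at the upper corner; solidity then puts the whole box into [S]. *)
Definition grid N : seq (corners R n) :=
  [seq grid_box k | k <- enum {ffun 'I_n -> 'I_(N + N)} &
    `[< S (\row_i (grid_box k).2 i) >]].

Lemma all_thin_grid N : all_thin (expR h) (grid N).
Proof.
move=> Q /mapP[k _ ->] i; rewrite /= !ffunE expR_gt0 ltr_expR -expRD.
rewrite !natrD ltr_pM2r// ler_expR; split; first by apply/andP; split=> //; lra.
by rewrite le_eqVlt; apply/orP; left; apply/eqP; ring.
Qed.

Lemma separated_grid N : separated (grid N).
Proof.
rewrite /separated pairwise_map; apply: pairwise_filter.
have := enum_uniq {ffun 'I_n -> 'I_(N + N)}; rewrite uniq_pairwise.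
apply: sub_pairwise => k k' /= kk'; apply/existsP.
have [i ki] : exists i, k i != k' i.
  apply/existsP; apply: contraNT kk'; rewrite negb_exists => /forallP kk'.
  by apply/eqP/ffunP => i; apply/eqP; rewrite -[_ == _]negbK kk'.
exists i; rewrite !ffunE !ler_expR !ler_pM2r// !lerD2r !ler_nat !addn1 !addn0.
by rewrite -neq_ltn.
Qed.

Lemma grid_upper N Q : Q \in grid N -> S (\row_i Q.2 i).
Proof. by move=> /mapP[k + ->]; rewrite mem_filter => /andP[/asboolP]. Qed.

Lemma grid_gt0 N x i : box_union (grid N) x -> 0 < x ord0 i.
Proof.
move=> [Q /= QN /hboxP/(_ i)/andP[Qx _]].
by apply: lt_le_trans Qx; have [/andP[]] := all_thin_grid QN i.
Qed.

Lemma grid_sub N : box_union (grid N) `<=` S.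
Proof.
move=> x xN; have [Q /= QN /hboxP xQ] := xN.
apply: (solidS (grid_upper QN)) => i; rewrite mxE.
have /andP[_ /ltW xQ2] := xQ i; have xi0 := ltW (grid_gt0 i xN).
by rewrite !ger0_norm// (le_trans xi0).
Qed.

Lemma grid_nondecreasing : nondecreasing_seq (fun N => box_union (grid N)).
Proof.
apply/nondecreasing_seqP => N; apply/subsetPset => x [Q /= QN xQ].
exists Q => //=; move: QN => /mapP[k + QE].
rewrite mem_filter => /andP[kS _].
(* Increasing N by one increases the index of a fixed box by one. *)
have kN i : ((k i).+1 < N.+1 + N.+1)%N by rewrite addSn addnS !ltnS ltnW.
have natE (j e : nat) : (j.+1 + e)%:R - N.+1%:R = (j + e)%:R - N%:R :> R.
  by rewrite addSn -[in LHS]natr1 -[N.+1%:R]natr1 opprD addrACA subrr addr0.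
have QE1 : Q = @grid_box N.+1 [ffun i => Ordinal (kN i)].
  by rewrite QE; congr pair; apply/ffunP => i; rewrite !ffunE/= natE.
rewrite [X in X \in _]QE1; apply/mapP; exists [ffun i => Ordinal (kN i)] => //.
by rewrite mem_filter -QE1 QE kS mem_enum.
Qed.

(** The upper corner of the cell around x is coordinatewise at most [expR h *: x], hence in [S] by
    solidity. *)
Lemma grid_cover (x : 'rV[R]_n) : (forall i, 0 < x ord0 i) -> S (expR h *: x) ->
  exists N, box_union (grid N) x.
Proof.
move=> x0 Sx; pose u i := ln (x ord0 i) / h.
have xE i : x ord0 i = expR (u i * h).
  by rewrite /u divfK ?gt_eqF// lnK// posrE.
pose N := (\sum_i (Num.trunc `|u i|).+1)%N.
have uN i : `|u i| < N%:R.
  by rewrite (lt_le_trans (truncnS_gt _))// ler_nat /N (bigD1 i)//= leq_addr.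
have uN0 i : 0 <= u i + N%:R.
  by have := uN i; rewrite ltr_norml => /andP[+ _]; lra.
have kN i : (Num.trunc (u i + N%:R)%R < N + N)%N.
  rewrite truncn_lt_nat// natrD ltrD2r.
  by have := uN i; rewrite ltr_norml => /andP[].
pose k := [ffun i => Ordinal (kN i)].
have kP i : ((k i)%:R <= u i + N%:R < (k i)%:R + 1)%R.
  by rewrite ffunE natr1; exact: truncn_itv.
have lo i : (grid_box k).1 i <= x ord0 i.
  rewrite ffunE xE ler_expR ler_pM2r// addn0 lerBlDr.
  by have /andP[] := kP i.
have hi i : x ord0 i < (grid_box k).2 i.
  rewrite ffunE xE ltr_expR ltr_pM2r// natrD ltrBrDr.
  by have /andP[] := kP i.
exists N; exists (grid_box k); last first.
  by apply/hboxP => i; rewrite lo hi.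
apply/mapP; exists k => //; rewrite mem_filter mem_enum andbT.
apply/asboolP; apply: (solidS Sx) => i; rewrite !mxE ffunE.
rewrite [leLHS]ger0_norm ?expR_ge0// [leRHS]ger0_norm; last first.
  by apply: mulr_ge0; rewrite ?expR_ge0// ltW.
rewrite xE -expRD ler_expR natrD.
rewrite (_ : h + u i * h = (1 + u i) * h) ?ler_pM2r//; last by ring.
by have /andP[kle _] := kP i; lra.
Qed.

End grid.

Section orthant_symmetry.
Context (R : realType) (n : nat) (mu : {measure set 'rV[R]_n -> \bar R}).
Hypothesis mu_flip : forall eps A, (forall i, eps i = -1 \/ eps i = 1) ->
  measurable A -> mu (flip eps @^-1` A) = mu A.

Definition abs_coords (s : seq 'I_n) (x : 'rV[R]_n) : 'rV[R]_n :=
  \row_i (if i \in s then `|x ord0 i| else x ord0 i).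

Lemma measurable_abs_coords s (E : set 'rV[R]_n) :
  measurable E -> measurable (abs_coords s @^-1` E).
Proof.
move=> mE; rewrite -[X in measurable X]setTI.
apply: (measurable_fun_rV (f := abs_coords s)) => // i.
under eq_fun do rewrite mxE.
case: (i \in s); last exact: measurable_coord.
apply: measurableT_comp; first exact: normr_measurable.
exact: measurable_coord.
Qed.

(** Each coordinate of [s] doubles the mass: the preimage is the union of a set with x_i > 0 and its
    reflection. *)
Lemma measure_abs_coords s (E : set 'rV[R]_n) : uniq s -> measurable E ->
  (forall x i, E x -> 0 < x ord0 i) ->
  mu (abs_coords s @^-1` E) = ((2 ^+ size s)%:E * mu E)%E.
Proof.
move=> us mE E0; elim: s us => [_|i s IH /= /andP[is_ us]].
  rewrite expr0 mul1e; congr (mu _); apply/seteqP; split=> x /=;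
    by congr E; apply/rowP => j; rewrite mxE.
pose eps j : R := if j == i then -1 else 1.
have eps1 j : eps j = -1 \/ eps j = 1 by rewrite /eps; case: eqP; [left|right].
have mEs := measurable_abs_coords s mE.
have Es0 x : (abs_coords s @^-1` E) x -> 0 < x ord0 i.
  by move=> /E0 - /(_ i); rewrite mxE (negbTE is_).
have -> : abs_coords (i :: s) @^-1` E =
    (abs_coords s @^-1` E) `|` (flip eps @^-1` (abs_coords s @^-1` E)).
  apply/seteqP; split=> x /= H.
    have [x0|x0] := leP 0 (x ord0 i); [left|right]; move: H; congr E;
      apply/rowP => j; rewrite !mxE inE /eps; case: eqP => [->|_] /=.
    - by rewrite (negbTE is_) ger0_norm.
    - by [].
    - by rewrite (negbTE is_) ltr0_norm// mulN1r.
    - by rewrite mul1r.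
  case: H => H; move: (Es0 _ H) (H); rewrite ?mxE /eps ?eqxx ?mulN1r ?oppr_gt0 => x0;
    congr E; apply/rowP => j; rewrite !mxE inE /eps; case: eqP => [->|_] /=.
  - by rewrite (negbTE is_) gtr0_norm.
  - by [].
  - by rewrite (negbTE is_) ltr0_norm// mulN1r.
  - by rewrite mul1r.
transitivity (mu (abs_coords s @^-1` E) + mu (flip eps @^-1` (abs_coords s @^-1` E)))%E.
  apply: measureU => //; first exact: measurable_flip_preimage.
  apply/seteqP; split=> x // -[/Es0 + /Es0]; rewrite mxE /eps eqxx mulN1r oppr_gt0.
  by move=> /lt_trans/[apply]; rewrite ltxx.
rewrite mu_flip// IH// [in RHS]exprS mulr_natl mulr2n EFinD ge0_muleDl//;
  by rewrite lee_fin exprn_ge0.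
Qed.

End orthant_symmetry.

(** This is how multiplicative losses are removed. A violation by finite x > y > 0 is refuted by h =
    ln (x / y) / 2. *)
Lemma le_expR_mul (R : realType) (x y : \bar R) : (0 <= y)%E ->
  (forall h : R, 0 < h -> (x <= (expR h)%:E * y)%E) -> (x <= y)%E.
Proof.
move=> y0 xy; rewrite leNgt; apply/negP => yx.
case: y y0 xy yx => [y| |]// y0 xy yx; last by rewrite ltNge leey in yx.
move: y0 xy yx; rewrite lee_fin le_eqVlt => /predU1P[<-|y0] xy yx.
  by have := xy 1 ltr01; rewrite mule0 leNgt yx.
case: x xy yx => [x| |]// xy yx; last first.
  by have := xy 1 ltr01; rewrite -EFinM leNgt ltry.
  rewrite lte_fin in yx; have x0 := lt_trans y0 yx.
  have h0 : 0 < ln (x / y) / 2.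
    by rewrite divr_gt0// ln_gt0// ltr_pdivlMr// mul1r.
  have := xy _ h0; rewrite -EFinM lee_fin leNgt -ltr_pdivlMr// => /negP; apply.
  rewrite -[ltRHS](@lnK _ (x / y)) ?posrE ?divr_gt0// ltr_expR.
  by rewrite ltr_pdivrMr// mulr_natr mulr2n ltrDl; move: h0; rewrite pmulr_lgt0.
Qed.

Section dilations.
Context (R : realType) (n : nat).
Implicit Types (A S : set 'rV[R]_n).

Lemma solid_dilate (a : R) A : solid A -> solid (dilate a A).
Proof.
move=> sA _ y [x Ax <-] yx; have [a0|a0] := eqVneq a 0.
  exists x => //; apply/rowP => i; apply/esym/eqP.
  have := yx i; rewrite !mxE a0 mul0r normr0 => yi.
  by rewrite -normr_eq0 eq_le yi normr_ge0.
exists (a^-1 *: y); last by rewrite scalerA divff// scale1r.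
apply: (sA _ _ Ax) => i; have := yx i; rewrite !mxE !normrM normfV.
by rewrite ler_pdivrMl ?normr_gt0.
Qed.

Lemma dilate_le (a b : R) A : solid A -> 0 <= a <= b ->
  dilate a A `<=` dilate b A.
Proof.
move=> sA /andP[a0 ab] _ [x Ax <-].
apply: (@solid_dilate b A sA (b *: x)); first by exists x.
move=> i; rewrite !mxE !normrM ler_wpM2r//.
by rewrite !ger0_norm// (le_trans a0).
Qed.

End dilations.

(** * Masses of the dilates of a solid convex set *)

Section dilation_measure.
Context (R : realType) (n : nat) (mu : {measure set 'rV[R]_n -> \bar R}).
Hypothesis n_gt0 : (0 < n)%N.
Hypothesis mu_flip : forall eps A, (forall i, eps i = -1 \/ eps i = 1) ->
  measurable A -> mu (flip eps @^-1` A) = mu A.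
Hypothesis mu_lc : log_concave_measure mu.
Hypothesis mu_hyp : forall i c, mu (hyperplane i c) = 0%E.
Variable A : set 'rV[R]_n.
Hypothesis solidA : solid A.
Hypothesis convexA : convex_set A.

Let F (a : R) := mu^* (dilate a A).

Let F_ge0 a : (0 <= F a)%E. Proof. exact: mu_ext_ge0. Qed.

Lemma dilation_le a b : 0 <= a <= b -> (F a <= F b)%E.
Proof. by move=> ab; apply: le_mu_ext; exact: dilate_le. Qed.

(** The 2^n reflections of [E] are disjoint and all lie in [S]. *)
Let orthant_le (E S : set 'rV[R]_n) : measurable E -> solid S -> E `<=` S ->
  (forall x i, E x -> 0 < x ord0 i) -> ((2 ^+ n)%:E * mu E <= mu^* S)%E.
Proof.
move=> mE sS ES E0.
have := measure_abs_coords mu_flip (enum_uniq 'I_n) mE E0.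
rewrite size_enum_ord => <-; rewrite -measurable_mu_extE; last first.
  exact: measurable_abs_coords.
apply: le_mu_ext => x /= /ES Sx; apply: (sS _ _ Sx) => i.
by rewrite mxE mem_enum normr_id.
Qed.

(** Shrinking by [expR (- h)] leaves room for a whole grid cell around the absolute values of each
    point off the coordinate hyperplanes, which are null. The cells thus exhaust the shrunk dilate,
    and the strict bound on y is reached by a finite stage N. *)
Let inner_boxes (a h : R) (y : \bar R) : 0 < a -> 0 < h ->
    (y < F (a * expR (- h)))%E ->
  exists X : seq (corners R n), [/\ all_thin (expR h) X, separated X,
    (forall Q, Q \in X -> dilate a A (\row_i Q.2 i)),
    box_union X `<=` dilate a A &
    (y < (2 ^+ n)%:E * mu (box_union X))%E].
Proof.
move=> a0 h0 yF; set S := dilate a A.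
have sS : solid S by exact: solid_dilate.
pose V N := abs_coords (enum 'I_n) @^-1` box_union (grid h S N).
have mV N : measurable (V N) by apply: measurable_abs_coords; exact: measurable_box_union.
pose W := \big[setU/set0]_(i < n) hyperplane i (0 : R).
have [mW W0] : measurable W /\ mu W = 0%E.
  rewrite /W; elim/big_rec : _ => [|i E _ [mE E0]]; first by rewrite measure0.
  have mi := @measurable_hyperplane R n i 0.
  split; first exact: measurableU.
  by have := measureU0 mi mE E0; rewrite mu_hyp.
have Fle : (F (a * expR (- h)) <= mu (\bigcup_N V N))%E.
  rewrite -(measureU0 (mu := mu) (bigcupT_measurable V mV) mW W0).
  rewrite -measurable_mu_extE; last first.
    by apply: measurableU => //; exact: bigcupT_measurable.
  apply: le_mu_ext => _ [x Ax <-].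
  have [[i xi0]|] := pselect (exists i, (a * expR (- h) *: x) ord0 i = 0).
    right; rewrite /W -bigcup_seq; exists i => //=.
    by rewrite mem_index_enum.
  move=> /forallNP x0; left.
  set z := _ *: x in x0 *.
  have [||N zN] := @grid_cover R n h S h0 sS (abs_coords (enum 'I_n) z).
  - by move=> i; rewrite mxE mem_enum normr_gt0; apply/eqP/x0.
  - apply: (sS (a *: x)); first by exists x.
    move=> i; rewrite !mxE mem_enum !normrM !normr_id.
    rewrite !(ger0_norm (expR_ge0 _)).
    have -> : expR h * (`|a| * expR (- h) * `|x ord0 i|) =
        expR h * expR (- h) * (`|a| * `|x ord0 i|) by ring.
    by rewrite -expRD subrr expR0 mul1r.
  by exists N.
have [N yN] : exists N, (y < mu (V N))%E.
  apply: contrapT => /forallNP noN; move: yF; apply/negP; rewrite -leNgt.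
  apply: (le_trans Fle); apply: measure_bigcup_le => //.
    move=> i j ij; apply/subsetPset => x.
    by apply: (subsetPset _ _ (grid_nondecreasing h S ij)).
  by move=> k; rewrite leNgt; apply/negP.
exists (grid h S N); split.
- exact: all_thin_grid.
- exact: separated_grid.
- exact: grid_upper.
- exact: grid_sub.
- move: yN; rewrite /V measure_abs_coords ?enum_uniq ?size_enum_ord//.
    exact: measurable_box_union.
  by move=> x i; exact: grid_gt0.
Qed.

Definition scale_corners (r : R) (Q : corners R n) : corners R n :=
  ([ffun i => r * Q.1 i], [ffun i => r * Q.2 i]).

(** For r <= 1 the scaled box is lower and smaller, with r^n times the volume, so [hbox_avg]
    compares the averages. *)
Let scale_corners_le (r rho : R) (Q : corners R n) : 0 < r <= 1 -> thin rho Q.1 Q.2 ->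
  ((r ^+ n)%:E * mu (hbox Q.1 Q.2) <=
   mu (hbox (scale_corners r Q).1 (scale_corners r Q).2))%E.
Proof.
move=> /andP[r0 r1] tQ; have r0' := ltW r0.
have Q0 i : 0 < Q.2 i - Q.1 i by rewrite subr_gt0; have [/andP[]] := tQ i.
have P0 : 0 < \prod_i (Q.2 i - Q.1 i) by exact: prodr_gt0.
have := @hbox_avg R n mu mu_flip mu_lc Q.1 Q.2 (scale_corners r Q).1 (scale_corners r Q).2.
rewrite (eq_bigr (fun i => r * (Q.2 i - Q.1 i))); last first.
  by move=> i _; rewrite !ffunE mulrBr.
rewrite big_split/= prodr_const card_ord mulrC EFinM -muleA lee_pmul2l//; apply=> i.
- have [/andP[Qi0 _] _] := tQ i; rewrite ffunE mulr_ge0 ?(ltW Qi0)//=.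
  by rewrite ler_piMl// ltW.
- by rewrite !ffunE ler_wpM2l// -subr_ge0 ltW.
- by rewrite -subr_ge0 ltW.
- have [/andP[Qi0 Qi] _] := tQ i.
  by rewrite ffunE ler_piMl// ltW// (lt_trans Qi0).
Qed.

Let box_union_cons (Q : corners R n) s : box_union (Q :: s) = hbox Q.1 Q.2 `|` box_union s.
Proof. by rewrite /box_union !bigcup_seq big_cons. Qed.

(** Subadditivity splits the left side; scaling preserves the separating coordinates, so the masses
    of the scaled boxes add up exactly. *)
Let scale_box_union_le (r rho : R) (X : seq (corners R n)) :
  0 < r <= 1 -> all_thin rho X -> separated X ->
  ((r ^+ n)%:E * mu (box_union X) <= mu (box_union (map (scale_corners r) X)))%E.
Proof.
move=> r01; have /andP[r0 r1] := r01.
elim: X => [|Q X IH] tX /=.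
  by rewrite /box_union set_nil bigcup_set0 measure0 mule0.
move=> /andP[/allP/= QX sX]; rewrite !box_union_cons.
apply: (@le_trans _ _
    ((r ^+ n)%:E * (mu (hbox Q.1 Q.2) + mu (box_union X)))%E).
  apply: lee_wpmul2l; first by rewrite lee_fin exprn_ge0// ltW.
  by apply: measureU2; [exact: measurable_hbox|exact: measurable_box_union].
have -> : mu (hbox (scale_corners r Q).1 (scale_corners r Q).2 `|`
      box_union (map (scale_corners r) X)) =
    (mu (hbox (scale_corners r Q).1 (scale_corners r Q).2) +
      mu (box_union (map (scale_corners r) X)))%E.
  apply: measureU; [exact: measurable_hbox|exact: measurable_box_union|].
  apply/seteqP; split=> x // -[/hboxP xQ [_ /= /mapP[P PX ->] /hboxP xP]].
  have /existsP[i] := QX P PX.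
  have /andP[+ +] := xQ i; have /andP[+ +] := xP i; rewrite !ffunE => P1 P2 Q1 Q2.
  case/orP; rewrite -(ler_pM2l r0) => QP.
    by have := le_lt_trans P1 (lt_le_trans Q2 QP); rewrite ltxx.
  by have := le_lt_trans Q1 (lt_le_trans P2 QP); rewrite ltxx.
rewrite ge0_muleDr//; apply: leeD.
  by apply: (scale_corners_le (rho := rho)) => //; apply: tX; rewrite mem_head.
by apply: IH => // P PX; apply: tX; rewrite inE PX orbT.
Qed.

Let scale_box_union_sub (r : R) (X : seq (corners R n)) (S : set 'rV[R]_n) : 0 < r ->
  box_union X `<=` S -> box_union (map (scale_corners r) X) `<=` dilate r S.
Proof.
move=> r0 XS x [_ /= /mapP[Q QX ->] /hboxP xQ].
exists (r^-1 *: x); last by rewrite scalerA divff ?gt_eqF// scale1r.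
apply: XS; exists Q => //; apply/hboxP => i; have := xQ i.
by rewrite !ffunE !mxE ler_pdivlMl// ltr_pdivrMl.
Qed.

Lemma dilate_dilate (a b : R) (S : set 'rV[R]_n) :
  dilate a (dilate b S) = dilate (a * b) S.
Proof.
apply/seteqP; split=> [_ [_ [x Sx <-] <-]|_ [x Sx <-]].
  by exists x => //; rewrite scalerA.
by exists (b *: x); [exists x|rewrite scalerA].
Qed.

(** Boxes inside the dilate by a e^h nearly exhaust F a; scaled by s e^(-h) they land in the dilate
    by s a. *)
Lemma dilation_ge (a s : R) : 0 < a -> 0 < s <= 1 ->
  ((s ^+ n)%:E * F a <= F (s * a))%E.
Proof.
move=> a0 /andP[s0 s1]; apply: le_expR_mul => // k k0.
(* Scaling by [expR (- h)] in dimension n then costs exactly [expR (- k)]. *)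
pose h := k / n%:R; have nR : 0 < n%:R :> R by rewrite ltr0n.
have h0 : 0 < h by rewrite divr_gt0.
have eh : expR k = expR h ^+ n by rewrite -expRM_natl /h mulrCA divff ?mulr1 ?gt_eqF.
have sh1 : 0 < s * expR (- h) <= 1.
  rewrite mulr_gt0 ?expR_gt0//= mulr_ile1 ?expR_ge0 ?(ltW s0)//.
  by rewrite -(expR0 R) ler_expR oppr_le0 ltW.
have ah0 : 0 < a * expR h by rewrite mulr_gt0 ?expR_gt0.
rewrite leNgt; apply/negP => FsF; pose c := (s * expR (- h)) ^+ n.
have c0 : 0 < c by rewrite exprn_gt0//; case/andP: sh1.
have [|||X [tX sX _ XA yX]] := @inner_boxes (a * expR h) h ((c^-1)%:E * F (s * a))%E => //.
  rewrite -mulrA -expRD subrr expR0 mulr1 lte_pdivrMl//.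
  have -> : c = (expR k)^-1 * s ^+ n.
    by rewrite /c exprMn expRN exprVn -eh mulrC.
  by rewrite EFinM -muleA lte_pdivlMl ?expR_gt0.
move: yX; rewrite lte_pdivrMl//; apply/negP; rewrite -leNgt.
have mX := measurable_box_union (map (scale_corners (s * expR (- h))) X).
have r0 : 0 < s * expR (- h) by case/andP: sh1.
apply: (@le_trans _ _ ((2 ^+ n)%:E * mu (box_union (map (scale_corners (s * expR (- h))) X)))%E).
  rewrite muleCA lee_wpmul2l ?lee_fin ?exprn_ge0//.
  exact: scale_box_union_le sh1 tX sX.
apply: orthant_le => //; first exact: solid_dilate.
  move=> x /(scale_box_union_sub r0 XA); rewrite dilate_dilate.
  rewrite (_ : s * expR (- h) * _ = s * a)//.
  by rewrite -mulrA (mulrCA (expR _)) -expRD addNr expR0 mulr1.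
move=> x i [_ /= /mapP[Q QX ->] /hboxP/(_ i)/andP[+ _]].
rewrite ffunE; apply: lt_le_trans; rewrite mulr_gt0//.
by have [/andP[]] := tX _ QX i.
Qed.

Lemma dilation_gmean (a b l : R) : 0 < a -> 0 < b -> 0 < l < 1 ->
  (F a < +oo)%E -> (F b < +oo)%E ->
  (F a `^ (1 - l) * F b `^ l <= F (gmean l a b))%E.
Proof.
move=> a0 b0 l01 aoo boo; have /andP[l0 l1] := l01.
have [->|Fa0] := eqVneq (F a) 0%E.
  by rewrite poweR0r ?mul0e// gt_eqF// subr_gt0.
have [->|Fb0] := eqVneq (F b) 0%E; first by rewrite poweR0r ?mule0// gt_eqF.
apply: le_expR_mul => // k k0.
(* Three losses of [expR h ^+ n] are budgeted: one for shrinking the dilates before boxes are taken,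
   one for making the bound strict, one in the Hadwiger-Ohmann inequality. *)
pose h := k / 3 / n%:R; have nR : 0 < n%:R :> R by rewrite ltr0n.
have h0 : 0 < h by rewrite !divr_gt0.
have eh : expR (k / 3) = expR h ^+ n.
  by rewrite -expRM_natl /h mulrCA divff ?mulr1 ?gt_eqF.
have ek : expR k = expR h ^+ n * expR h ^+ n * expR h ^+ n.
  by rewrite -!eh -!expRD; congr expR; field.
pose e := expR h ^+ n.
have e1 : 1 < e by rewrite /e -eh expR_gt1 divr_gt0.
have e0 : 0 < e by exact: lt_trans e1.
have ehle : expR (- h) <= 1 by rewrite -(expR0 R) ler_expR oppr_le0 ltW.
have boxes c : 0 < c -> (F c < +oo)%E -> F c != 0%E ->
    exists X : seq (corners R n), [/\ all_thin (expR h) X, separated X,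
    (forall Q, Q \in X -> dilate c A (\row_i Q.2 i)),
    box_union X `<=` dilate c A &
    ((e ^- 2)%:E * F c <= (2 ^+ n)%:E * mu (box_union X))%E].
  move=> c0 coo Fc0.
  have [|||X [? ? ? ? /ltW ?]] := @inner_boxes c h ((e ^- 2)%:E * F c)%E => //.
    have /(lt_le_trans _) : ((e^-1)%:E * F c <= F (c * expR (- h)))%E.
      have := @dilation_ge c (expR (- h)) c0.
      by rewrite expR_gt0 ehle mulrC expRN exprVn; apply.
    apply; rewrite lte_pmul2r ?lte_fin.
    - by rewrite expr2 invfM gtr_pMl ?invr_gt0// invf_lt1.
    - by rewrite ge0_fin_numE.
    - by rewrite lt0e Fc0 F_ge0.
  by exists X.
have [X [tX sX cX XA FX]] := boxes _ a0 aoo Fa0.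
have [Y [tY sY cY YA FY]] := boxes _ b0 boo Fb0.
pose Z : set 'rV[R]_n := \bigcup_(P in [set` [seq (Q, Q') | Q <- X, Q' <- Y]])
  gbox (expR h) l P.1.1 P.1.2 P.2.1 P.2.2.
have mZ : measurable Z.
  rewrite /Z bigcup_seq; apply: bigsetU_measurable => P _.
  exact: measurable_hbox.
have Z0 x i : Z x -> 0 < x ord0 i.
  move=> [[? ?] /= /allpairsP[[Q Q'] /= [QX Q'Y [-> ->]]] /hboxP/(_ i)/andP[+ _]].
  apply: lt_le_trans; rewrite divr_gt0 ?expR_gt0// gmean_gt0//.
    by have [/andP[]] := tX _ QX i.
  by have [/andP[]] := tY _ Q'Y i.
(* Convexity of A enters here. The upper corners are a u and b v with u and v in A, so the mean box
   lies coordinatewise below [gmean l a b] times (1 - l) u + l v, and solidity concludes. *)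
have ZS : Z `<=` dilate (gmean l a b) A.
  move=> x Zx; move: (Zx) => [[? ?] /= /allpairsP[[Q Q'] /= [QX Q'Y [-> ->]]] /hboxP xQ].
  have [u Au uQ] := cX _ QX; have [v Av vQ'] := cY _ Q'Y.
  have Awv : A ((1 - l) *: u + l *: v) by apply: convex_setE => //; rewrite !ltW.
  apply: (solid_dilate solidA (a := gmean l a b) (x := gmean l a b *: ((1 - l) *: u + l *: v))).
    by eexists; first exact: Awv.
  move=> i; have /andP[_ /ltW xlt] := xQ i; rewrite !mxE.
  have ui : Q.2 i = a * u ord0 i by have /rowP/(_ i) := uQ; rewrite !mxE.
  have vi : Q'.2 i = b * v ord0 i by have /rowP/(_ i) := vQ'; rewrite !mxE.
  have [/andP[Q10 Q12] _] := tX _ QX i; have [/andP[Q'10 Q'12] _] := tY _ Q'Y i.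
  have u0 : 0 < u ord0 i by rewrite -(pmulr_rgt0 _ a0) -ui (lt_trans Q10).
  have v0 : 0 < v ord0 i by rewrite -(pmulr_rgt0 _ b0) -vi (lt_trans Q'10).
  rewrite gtr0_norm ?Z0// gtr0_norm; last first.
    by rewrite mulr_gt0 ?gmean_gt0// addr_gt0 ?mulr_gt0 ?subr_gt0.
  apply: (le_trans xlt); rewrite ui vi gmeanM ?(ltW a0) ?(ltW b0) ?(ltW u0) ?(ltW v0)//.
  rewrite -mulrA ler_pM2l ?gmean_gt0// ler_pdivrMr ?expR_gt0//.
  apply: (le_trans (gmean_le l01 (ltW u0) (ltW v0))).
  have uv0 : 0 <= (1 - l) * u ord0 i + l * v ord0 i.
    by rewrite addr_ge0// mulr_ge0 ?subr_ge0// ltW.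
  rewrite ler_peMr//.
  by rewrite -(expR0 R) ler_expR ltW.
have FZ : ((2 ^+ n)%:E * mu Z <= F (gmean l a b))%E.
  by apply: orthant_le => //; exact: solid_dilate.
have finX (c : R) (W : seq (corners R n)) : all_thin (expR h) W -> box_union W `<=` dilate c A ->
    (F c < +oo)%E -> (mu (box_union W) < +oo)%E.
  move=> tW WA; apply: le_lt_trans; rewrite -measurable_mu_extE; last first.
    exact: measurable_box_union.
  exact: le_mu_ext.
have eh1 : 1 <= expR h by rewrite -(expR0 R) ler_expR ltW.
have := @hadwiger_ohmann R n mu mu_flip mu_lc mu_hyp (expR h) eh1 l X Y Z l01.
rewrite /gmean_ineq -/e => /(_ _ _ mZ _) HO.
have {}HO : (mu (box_union X) `^ (1 - l) * mu (box_union Y) `^ l <= e%:E * mu Z)%E.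
  apply: HO; first by split=> //; exact: finX XA aoo.
    by split=> //; exact: finX YA boo.
  move=> Q Q' QX Q'Y x xQ; exists (Q, Q') => //=.
  by apply/allpairsP; exists (Q, Q').
have em0 : 0 < e ^- 2 by rewrite invr_gt0 exprn_gt0.
have p2 : 0 < 2 ^+ n :> R by rewrite exprn_gt0.
have : ((e ^- 2)%:E * (F a `^ (1 - l) * F b `^ l) <= e%:E * F (gmean l a b))%E.
  have -> : ((e ^- 2)%:E * (F a `^ (1 - l) * F b `^ l) =
      ((e ^- 2)%:E * F a) `^ (1 - l) * ((e ^- 2)%:E * F b) `^ l)%E.
    rewrite !poweRM ?lee_fin ?(ltW em0)// muleACA !poweR_EFin -EFinM.
    by rewrite -/(gmean l _ _) gmeanxx.
  apply: (@le_trans _ _ (((2 ^+ n)%:E * mu (box_union X)) `^ (1 - l) *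
      ((2 ^+ n)%:E * mu (box_union Y)) `^ l)%E).
    apply: lee_pmul; rewrite ?poweR_ge0//; apply: le_poweR => //;
      by rewrite ?mule_ge0 ?lee_fin ?subr_ge0 ?(ltW em0) ?(ltW l0) ?(ltW l1).
  rewrite !poweRM ?lee_fin ?(ltW p2)// muleACA !poweR_EFin -EFinM.
  rewrite -/(gmean l _ _) gmeanxx//.
  apply: (@le_trans _ _ ((2 ^+ n)%:E * (e%:E * mu Z))%E).
    by rewrite lee_wpmul2l// lee_fin ltW.
  by rewrite muleCA lee_wpmul2l// lee_fin ltW.
rewrite lee_pdivrMl; last exact: exprn_gt0.
rewrite muleA -EFinM => /le_trans; apply.
by rewrite ek -/e expr2.
Qed.

End dilation_measure.

(** A power with exponent q in [0, 1] lies below its tangent at w = (1 - l) + l u; this tangent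
    bound is the weighted mean inequality for 1 and x / w. *)
Lemma powR_concave (R : realType) (q l u : R) : 0 <= q <= 1 -> 0 < l < 1 ->
  0 < u -> (1 - l) + l * u `^ q <= ((1 - l) + l * u) `^ q.
Proof.
move=> /andP[q0 q1] /andP[l0 l1] u0; set w := (1 - l) + l * u.
have l1' : 0 < 1 - l by rewrite subr_gt0.
have w0 : 0 < w by rewrite addr_gt0// mulr_gt0.
have gm x : 0 < x -> x `^ q <= ((1 - q) + q * (x / w)) * w `^ q.
  move=> x0; have xw0 : 0 < x / w by rewrite divr_gt0.
  have -> : x `^ q = (x / w) `^ q * w `^ q.
    by rewrite -powRM ?(ltW xw0) ?(ltW w0)// divfK ?gt_eqF.
  rewrite ler_pM2r ?powR_gt0//.
  have [->|qneq0] := eqVneq q 0; first by rewrite powRr0 subr0 mul0r addr0.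
  have [->|qneq1] := eqVneq q 1; first by rewrite powRr1 ?(ltW xw0)// subrr add0r mul1r.
  have q01 : 0 < q < 1 by rewrite !lt_neqAle q0 q1 eq_sym qneq0 qneq1.
  by have := gmean_le q01 ler01 (ltW xw0); rewrite /gmean powR1 mul1r mulr1.
have g1 := gm 1 ltr01; rewrite powR1 in g1.
have gu := gm u u0.
have : (1 - l) * 1 + l * u `^ q <=
  (1 - l) * (((1 - q) + q * (1 / w)) * w `^ q) + l * (((1 - q) + q * (u / w)) * w `^ q).
  by rewrite lerD// ler_pM2l.
rewrite mulr1 => /le_trans; apply.
rewrite le_eqVlt; apply/orP; left; apply/eqP.
have -> : (1 - l) * ((1 - q + q * (1 / w)) * w `^ q) +
    l * ((1 - q + q * (u / w)) * w `^ q) =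
    ((1 - q) + q * ((1 - l + l * u) / w)) * w `^ q by ring.
by rewrite -/w divff ?gt_eqF// mulr1 subrK mul1r.
Qed.

Lemma gmean_inv (R : realType) (a b t : R) : 0 < a -> a < t < b ->
  exists2 r, 0 < r < 1 & t = gmean r a b.
Proof.
move=> a0 /andP[at_ tb]; have t0 := lt_trans a0 at_; have b0 := lt_trans t0 tb.
have lab : 0 < ln b - ln a by rewrite subr_gt0 ltr_ln// (lt_trans at_).
exists ((ln t - ln a) / (ln b - ln a)).
  have lta : 0 < ln t - ln a by rewrite subr_gt0 ltr_ln.
  by rewrite divr_gt0//= ltr_pdivrMr// mul1r ltrD2r ltr_ln.
rewrite /gmean /powR !gt_eqF// -expRD -[LHS](@lnK _ t)//; congr expR.
by field; rewrite gt_eqF.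
Qed.

(* Writing g b = g a * (b / a) ^ q, the two one-sided bounds on g b / g a say
   that q is in [0, 1], so u ^ q is concave. *)
Lemma gmean_concave_homo (R : realType) (g : R -> R) (a b l : R) :
  0 < a -> a < b -> 0 < l < 1 -> 0 < g a -> g a <= g b -> g b <= b / a * g a ->
  (forall r, 0 < r < 1 -> gmean r (g a) (g b) <= g (gmean r a b)) ->
  (1 - l) * g a + l * g b <= g ((1 - l) * a + l * b).
Proof.
move=> a0 ab l01 ga0 gab gba glc; have b0 := lt_trans a0 ab.
have /andP[l0 l1] := l01.
have gb0 : 0 < g b by exact: lt_le_trans gab.
have ba1 : 1 < b / a by rewrite ltr_pdivlMr// mul1r.
have lba : 0 < ln (b / a) by rewrite ln_gt0.
pose q := ln (g b / g a) / ln (b / a).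
have q01 : 0 <= q <= 1.
  rewrite divr_ge0 ?ln_ge0 ?ler_pdivlMr ?mul1r ?(ltW ab)//=.
  rewrite ler_pdivrMr// mul1r ler_ln ?posrE ?divr_gt0//.
  by rewrite ler_pdivrMr.
have gbE : g b / g a = (b / a) `^ q.
  by rewrite /powR gt_eqF ?divr_gt0// /q divfK ?gt_eqF// lnK// posrE divr_gt0.
set t := (1 - l) * a + l * b.
have tab : a < t < b by rewrite /t; apply/andP; split; nra.
have [r r01 tE] := gmean_inv a0 tab.
rewrite tE; apply: le_trans (glc r r01).
have gmE x y : 0 < x -> 0 < y -> gmean r x y = x * (y / x) `^ r.
  move=> x0 y0; have yx0 : 0 < y / x by rewrite divr_gt0.
  have {1}-> : y = x * (y / x) by rewrite mulrC divfK ?gt_eqF.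
  by rewrite -{1}[x]mulr1 gmeanM ?(ltW x0) ?(ltW yx0)// gmeanxx// /gmean powR1 mul1r.
(* As t / a = (b / a)^r, the geometric mean of the values is g a (t / a)^q, to which concavity of
   the power applies. *)
rewrite gmE// gbE -powRrM [q * r]mulrC powRrM.
have <- : t / a = (b / a) `^ r by rewrite tE gmE// [a * _]mulrC mulfK ?gt_eqF.
rewrite [leRHS]mulrC -ler_pdivrMr// mulrDl -!mulrA divff ?gt_eqF// mulr1 gbE.
apply: le_trans (powR_concave q01 l01 _) _; first by rewrite divr_gt0.
suff -> : t / a = 1 - l + l * (b / a) by [].
by rewrite /t mulrDl -!mulrA divff ?gt_eqF// mulr1.
Qed.

Lemma gmean_powR (R : realType) (l r x y : R) :
  gmean l x y `^ r = gmean l (x `^ r) (y `^ r).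
Proof.
rewrite /gmean (powRM r (powR_ge0 x (1 - l)) (powR_ge0 y l)).
have AC (u s : R) : (u `^ s) `^ r = (u `^ r) `^ s.
  by rewrite -(powRrM u s r) (mulrC s r) (powRrM u r s).
by rewrite (AC x (1 - l)) (AC y l).
Qed.

(** * Concavity along the dilates *)

Section homothetic.
Context (R : realType) (n : nat) (mu : {measure set 'rV[R]_n -> \bar R}).
Hypothesis n_gt0 : (0 < n)%N.
Hypothesis unc_mu : unconditional_measure mu.
Hypothesis mu_lc : log_concave_measure mu.
Variable A : set 'rV[R]_n.
Hypothesis unc_A : unconditional_set A.
Hypothesis convexA : convex_set A.

Let mu_flip eps E : (forall i, eps i = -1 \/ eps i = 1) ->
  measurable E -> mu (flip eps @^-1` E) = mu E.
Proof. exact: unconditional_flip. Qed.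

Let mu_hyp i c : mu (hyperplane i c) = 0%E.
Proof. by have [phi dphi _] := unc_mu; exact: density_hyperplane dphi. Qed.

Let solidA : solid A. Proof. exact: unconditional_convex_solid. Qed.

Let F (a : R) := mu^* (dilate a A).

Let F_ge0 a : (0 <= F a)%E. Proof. exact: mu_ext_ge0. Qed.

Let F_le a b : 0 <= a <= b -> (F a <= F b)%E.
Proof. exact: dilation_le. Qed.

Let F_scale a s : 0 < a -> 0 < s <= 1 -> ((s ^+ n)%:E * F a <= F (s * a))%E.
Proof. exact: (dilation_ge n_gt0 mu_flip). Qed.

(** Finiteness passes to smaller factors by monotonicity and to larger ones by F b <= (b / a)^n F
    a. *)
Let F_lty a b : 0 < a -> 0 < b -> (F a < +oo)%E -> (F b < +oo)%E.
Proof.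
move=> a0 b0 aoo; have [ba|ab] := leP b a.
  by apply: le_lt_trans aoo; apply: F_le; rewrite ltW.
have s01 : 0 < a / b <= 1 by rewrite divr_gt0//= ler_pdivrMr// mul1r ltW.
have := F_scale b0 s01; rewrite divfK ?gt_eqF// => Fba.
have := le_lt_trans Fba aoo.
have s0 : 0 < (a / b) ^+ n by rewrite exprn_gt0//; case/andP: s01.
by case: (F b) => [r _| |]//; [rewrite ltry|rewrite gt0_muley].
Qed.

Let F_concave_lt a b l : 0 < a < b -> 0 < l < 1 ->
  ((1 - l)%:E * F a `^ n%:R^-1 + l%:E * F b `^ n%:R^-1 <=
   F ((1 - l) * a + l * b)%R `^ n%:R^-1)%E.
Proof.
move=> /andP[a0 ab] l01; have b0 := lt_trans a0 ab; have /andP[l0 l1] := l01.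
have t0 : 0 < (1 - l) * a + l * b by rewrite addr_gt0// mulr_gt0// subr_gt0.
have n0 : 0 < n%:R^-1 :> R by rewrite invr_gt0 ltr0n.
have [Foo|Foo] := eqVneq (F ((1 - l) * a + l * b)) +oo%E.
  by rewrite Foo poweRyr ?gt_eqF// leey.
have fin c : 0 < c -> F c \is a fin_num.
  move=> c0; rewrite ge0_fin_numE//; apply: (F_lty t0) => //.
  by rewrite lt_neqAle Foo leey.
pose f c := fine (F c); have FE c : 0 < c -> F c = (f c)%:E.
  by move=> c0; rewrite /f fineK// fin.
have f0 c : 0 <= f c by rewrite fine_ge0.
clearbody f.
rewrite !FE// !poweR_EFin -!EFinM -EFinD lee_fin.
have flet c d : 0 < c -> c <= d -> f c <= f d.
  by move=> c0 cd; rewrite -lee_fin -!FE ?(lt_le_trans c0)// F_le// cd ltW.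
have fscale : (a / b) ^+ n * f b <= f a.
  rewrite -lee_fin EFinM -!FE//.
  have := @F_scale b (a / b) b0; rewrite divfK ?gt_eqF//; apply.
  by rewrite divr_gt0//= ler_pdivrMr// mul1r ltW.
have [fa0|fa0] := eqVneq (f a) 0.
  have fb0 : f b = 0.
    apply/eqP; rewrite eq_le f0 andbT.
    by move: fscale; rewrite fa0 pmulr_rle0// exprn_gt0// divr_gt0.
  by rewrite fa0 fb0 !powR0 ?gt_eqF// !mulr0 addr0 powR_ge0.
apply: (@gmean_concave_homo R (fun c => f c `^ n%:R^-1)) => //.
- by rewrite powR_gt0// lt0r fa0 f0.
- by apply: ge0_ler_powR; rewrite ?nnegrE ?f0 ?(ltW n0)// flet// ltW.
- have -> : b / a = ((b / a) ^+ n) `^ n%:R^-1.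
    have ba : 0 <= b / a by rewrite divr_ge0 ?ltW.
    by rewrite -powR_mulrn// -powRrM divff ?powRr1// pnatr_eq0 -lt0n.
  rewrite -powRM ?exprn_ge0 ?f0//; last by rewrite divr_ge0 ?ltW.
  apply: ge0_ler_powR; rewrite ?nnegrE ?(ltW n0)//.
    by rewrite mulr_ge0 ?exprn_ge0 ?divr_ge0 ?(ltW a0) ?(ltW b0).
  move: fscale; rewrite -[a / b]invf_div exprVn ler_pdivrMl// exprn_gt0//.
  by rewrite divr_gt0.
- move=> r r01; have g0 : 0 < gmean r a b by exact: gmean_gt0.
  have <- : (f a `^ (1 - r) * f b `^ r) `^ n%:R^-1 =
      gmean r (f a `^ n%:R^-1) (f b `^ n%:R^-1).
    exact: gmean_powR.
  apply: ge0_ler_powR; rewrite ?nnegrE ?(ltW n0) ?f0//.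
    by rewrite mulr_ge0 ?powR_ge0.
  have := dilation_gmean n_gt0 mu_flip mu_lc mu_hyp solidA convexA a0 b0 r01.
  rewrite -!/(F _) !FE// !poweR_EFin -EFinM lee_fin; apply; exact: ltry.
Qed.

Let F_concave a b l : 0 < a -> 0 < b -> 0 <= l <= 1 ->
  ((1 - l)%:E * F a `^ n%:R^-1 + l%:E * F b `^ n%:R^-1 <=
   F ((1 - l) * a + l * b)%R `^ n%:R^-1)%E.
Proof.
move=> a0 b0 /andP[]; rewrite le_eqVlt => /predU1P[<- _|l0].
  by rewrite subr0 mul1e mul0e adde0 mul1r mul0r addr0.
rewrite le_eqVlt => /predU1P[->|l1].
  by rewrite subrr mul1e mul0e add0e mul1r mul0r add0r.
have [ab|ba|<-] := ltgtP a b.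
- by apply: F_concave_lt; rewrite ?a0 ?l0.
- have := @F_concave_lt b a (1 - l); rewrite b0 ba subr_gt0 l1 gtrBl l0.
  have -> : 1 - (1 - l) = l by ring.
  by rewrite addeC [l * b + _]addrC; apply.
- have -> : (1 - l) * a + l * a = a by ring.
  by rewrite -ge0_muleDl ?lee_fin ?subr_ge0 ?(ltW l0) ?(ltW l1)// -EFinD subrK mul1e.
Qed.

Lemma homothetic_concave (A1 A2 : set 'rV[R]_n) :
  [set dilate a A | a in [set a : R | 0 < a]] A1 ->
  [set dilate a A | a in [set a : R | 0 < a]] A2 ->
  forall l : R, 0 <= l <= 1 ->
    ((1 - l)%:E * mu^* A1 `^ n%:R^-1 + l%:E * mu^* A2 `^ n%:R^-1 <=
     mu^* (minkowski_sum (dilate (1 - l) A1) (dilate l A2)) `^ n%:R^-1)%E.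
Proof.
move=> [a a0 <-] [b b0 <-] l l01.
apply: (le_trans (F_concave a0 b0 l01)).
apply: le_poweR; rewrite ?invr_ge0//.
(* The dilate by (1 - l) a + l b lies in the Minkowski sum: split the multiple of x into (1 - l) a x
   and l b x. *)
apply: le_mu_ext => _ [x Ax <-].
exists ((1 - l) *: (a *: x)); first by exists (a *: x) => //; exists x.
exists (l *: (b *: x)); first by exists (b *: x) => //; exists x.
by rewrite !scalerA -scalerDl.
Qed.

End homothetic.

(** * Unimodal measures on the line *)

Section lebesgue_line.
Context (R : realType).
Local Notation lam := (@lebesgue_measure R).
Implicit Types (A B E I : set R).

(** The preimage of A under this map is k A + c for k > 0; as a preimage it is visibly
    measurable. *)
Definition affine_inv (k c x : R) : R := (x - c) / k.

Lemma measurable_affine_inv k c A :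
  measurable A -> measurable (affine_inv k c @^-1` A).
Proof.
move=> mA; rewrite -[X in measurable X]setTI.
have mf : measurable_fun setT (affine_inv k c).
  by apply: measurable_funM => //; exact: measurable_funB.
exact: mf.
Qed.

(** Uniqueness of Lebesgue measure: 1 / k times the length of k A + c agrees with length on
    intervals. *)
Lemma lebesgue_affine (k c : R) A : 0 < k -> measurable A ->
  lam (affine_inv k c @^-1` A) = (k%:E * lam A)%E.
Proof.
move=> k0 mA.
have mf : measurable_fun setT (affine_inv k c : measurableTypeR R -> measurableTypeR R).
  by apply: measurable_funM => //; exact: measurable_funB.
have k0' : 0 <= k^-1 by rewrite invr_ge0 ltW.
have := @lebesgue_measure_unique R (mscale (NngNum k0')
  (pushforward lam (affine_inv k c : measurableTypeR R -> measurableTypeR R))).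
move=> /(_ mf) H; rewrite [in RHS]H//.
  transitivity (k%:E * (k^-1%:E * lam (affine_inv k c @^-1` A)))%E => //.
  by rewrite muleA -EFinM divff ?gt_eqF// mul1e.
move=> _ [[a b]] _ <-.
transitivity (k^-1%:E * lam (affine_inv k c @^-1` `]a, b]%classic))%E => //.
have -> : affine_inv k c @^-1` `]a, b]%classic = `]k * a + c, k * b + c]%classic.
  apply/seteqP; split=> x /=; rewrite !in_itv/= /affine_inv ltr_pdivlMr// ler_pdivrMr//;
    by rewrite ltrBrDr lerBlDr ![_ * k]mulrC.
rewrite !lebesgue_measure_itv/= !lte_fin ltrD2r ltr_pM2l//.
case: ifPn => _; last by rewrite mule0.
by rewrite -!EFinB -EFinM; congr (_%:E); field; rewrite gt_eqF.
Qed.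

Section layers.
Variables (phi : R -> R) (E : set R).
Hypotheses (mphi : measurable_fun setT phi) (mE : measurable E).

Let hypograph : set (measurableTypeR R * measurableTypeR R) :=
  [set z | E z.1 /\ (0 <= z.2 < phi z.1)%R].

Let measurable_hypograph : measurable hypograph.
Proof.
have -> : hypograph = (E `*` `[0, +oo[) `&`
    (fun z : measurableTypeR R * measurableTypeR R => phi z.1 - z.2) @^-1` `]0, +oo[.
  apply/seteqP; split=> -[x t] /=; rewrite !in_itv/= !andbT subr_gt0.
    by move=> [? /andP[]].
  by move=> [[Ex t0] tx]; split=> //=; rewrite t0.
apply: measurableI; first exact: measurableX.
rewrite -[X in measurable X]setTI.
have mf : measurable_fun setT
    (fun z : measurableTypeR R * measurableTypeR R => phi z.1 - z.2).
  apply: measurable_funB; last exact: measurable_snd.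
  by apply: measurableT_comp => //; exact: measurable_fst.
by apply: mf => //; exact: measurable_itv.
Qed.

Let ysection_hypograph t :
  ysection hypograph t = E `&` [set x | (0 <= t < phi x)%R].
Proof. by apply/seteqP; split=> x; rewrite /ysection/= inE. Qed.

Lemma measurable_fun_layer : measurable_fun [set: measurableTypeR R]
  (fun t => lam (E `&` [set x | (0 <= t < phi x)%R])).
Proof.
have := measurable_fun_ysection lam measurable_hypograph.
apply: eq_measurable_fun => t _ /=.
by rewrite ysection_hypograph.
Qed.

(** Tonelli on the part over E of the hypograph. The condition 0 <= t inside the layer lets t run
    over the whole line. *)
Lemma layer_cake : (forall x, 0 <= phi x) ->
  (\int[lam]_(x in E) (phi x)%:E =
   \int[lam]_t lam (E `&` [set x | (0 <= t < phi x)%R]))%E.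
Proof.
move=> phi0; have := indic_fubini_tonelli lam lam measurable_hypograph.
rewrite (indic_fubini_tonelli_FE lam measurable_hypograph).
rewrite (indic_fubini_tonelli_GE lam measurable_hypograph).
have -> : (\int[lam]_x (lam \o xsection hypograph) x =
    \int[lam]_(x in E) (phi x)%:E)%E.
  rewrite [in RHS]integral_mkcond; apply: eq_integral => x _.
  rewrite /= patchE; case: ifPn => [|]; rewrite ?inE ?notin_setE => xE.
    rewrite (_ : xsection hypograph x = `[0, phi x[%classic).
      rewrite lebesgue_measure_itv/= lte_fin; case: ltP => [_|phi_le0].
        by rewrite sube0.
      by congr (_%:E); apply/eqP; rewrite eq_le phi0.
    by apply/seteqP; split=> t; rewrite /xsection/= inE /hypograph/= in_itv/= => // -[].
  transitivity (lam (set0 : set R)); last by rewrite measure0.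
  congr (lam _); by apply/seteqP; split=> t //; rewrite /xsection/= inE => -[].
by move=> ->; apply: eq_integral => t _ /=; rewrite ysection_hypograph.
Qed.

End layers.

End lebesgue_line.

(** * Brunn-Minkowski on the line, inside an interval *)

Section line_sums.
Context (R : realType).
Local Notation lam := (@lebesgue_measure R).
Implicit Types (A B E I : set R).

(** Countability keeps unions of translates by these points Borel; [d 0 = 0] puts a point of the
    sequence into every interval containing 0. *)
Definition dense_in A (d : nat -> R) := [/\ d 0%N = 0, forall k, A (d k) &
  forall p q x, A x -> p < x < q -> exists k, p < d k < q].

Lemma dense_in_exists A : A 0 -> exists d, dense_in A d.
Proof.
move=> A0.
pose P (pq : rat * rat) x := A x /\ ratr pq.1 < x < ratr pq.2.
pose g pq : R := if pselect (exists x, P pq x) is left H then sval (cid H) else 0.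
(* All default values are 0, which belongs to A; index 0 is reserved for it. *)
exists (fun k => if k is k.+1 then oapp g 0 (unpickle k) else 0); split=> //.
  move=> [//|k]; case: (unpickle k) => [pq|//] /=.
  by rewrite /g; case: pselect => // H; have [] := svalP (cid H).
move=> p q x Ax /andP[px xq].
have [p' /itvP p'P] := rat_in_itvoo px; have [q' /itvP q'P] := rat_in_itvoo xq.
exists (pickle (p', q')).+1; rewrite pickleK /= /g.
case: pselect => [H|[]]; last by exists x; rewrite /P/= p'P q'P.
have [_ /andP[/= h1 h2]] := svalP (cid H).
by rewrite (lt_trans _ h1) ?p'P// (lt_trans h2)// q'P.
Qed.

(** The classical one-dimensional argument uses the extreme points of compact sets. The part of A in
    I may have none, so bounds are proved up to the points d k of I and passed to the limit. *)
Lemma lebesgue_exhaust_le A I (d : nat -> R) (c : \bar R) :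
  measurable A -> measurable I -> is_interval I -> I 0 -> dense_in A d ->
  (forall k, I (d k) -> (lam (A `&` I `&` `]-oo, d k]) <= c)%E) ->
  (lam (A `&` I) <= c)%E.
Proof.
move=> mA mI itvI I0 [d0 dA dd] dc.
pose a (k : nat) := \big[Num.max/0]_(j < k | `[< I (d j) >]) d j.
have aI k : exists2 j, I (d j) & a k = d j.
  rewrite /a; elim/big_ind : _ => [|x y [i Ii ->] [j Ij ->]|i /asboolP Ii].
  - by exists 0%N; rewrite d0.
  - by have [_|_] := leP (d i) (d j); [exists j|exists i].
  - by exists i.
pose F k := A `&` I `&` `]-oo, a k].
have mF k : measurable (F k) by apply: measurableI => //; exact: measurableI.
have mAI : measurable (A `&` I) by exact: measurableI.
have UFc : (lam (\bigcup_k F k) <= c)%E.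
  apply: measure_bigcup_le => //.
    move=> i j ij; apply/subsetPset => x [AIx /=]; rewrite in_itv/= => xa.
    split=> //=; rewrite in_itv/= (le_trans xa)//.
    rewrite /a (big_ord_widen_cond _ (fun k => `[< I (d k) >]) d ij).
    apply: bigmax_le => [|k /andP[Ik _]].
      by apply: bigmax_ge_id.
    exact: le_bigmax_cond.
  by move=> k; have [j Ij aj] := aI k; rewrite /F aj; exact: dc.
pose S := (A `&` I) `\` \bigcup_k F k.
have Sd x k : S x -> I (d k) -> d k < x.
  move=> [AIx nF] Ik; rewrite ltNge; apply/negP => xd; apply: nF.
  exists k.+1 => //; split=> //=; rewrite in_itv/= (le_trans xd)//.
  rewrite /a; apply: (le_bigmax_cond _ (fun j : 'I_k.+1 => d j) (j := ord_max)).
  exact/asboolP.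
(* S has at most two points: density gives a d k in I between the extreme ones
   of any three, hence above the least one. *)
have S3 x z y : x < z < y -> S x -> S z -> S y -> False.
  move=> /andP[xz zy] Sx [[Az Iz] _] Sy.
  have [k /andP[xk ky]] := dd x y z Az (introT andP (conj xz zy)).
  have [[Ax Ix] _] := Sx; have [[Ay Iy] _] := Sy.
  have Ik : I (d k) by apply: (itvI _ _ Ix Iy); rewrite (ltW xk) (ltW ky).
  by have := lt_trans xk (Sd _ _ Sx Ik); rewrite ltxx.
have mS : measurable S by apply: measurableD => //; exact: bigcupT_measurable.
have S0 : lam S = 0%E.
  have [[x Sx]|/set0P/negP/negbNE/eqP ->] := pselect (S !=set0); last by rewrite measure0.
  have [[y [Sy /eqP yx]]|noy] := pselect (exists y, S y /\ y <> x); last first.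
    rewrite (_ : S = [set x]) ?lebesgue_measure_set1//.
    apply/seteqP; split=> [y Sy|_ ->]//=.
    by apply: contrapT => yx; apply: noy; exists y.
  apply/eqP; rewrite eq_le measure_ge0 andbT.
  apply: (@le_trans _ _ (lam ([set x] `|` [set y]))); last first.
    apply: (@le_trans _ _ (lam [set x] + lam [set y]))%E; first exact: measureU2.
    by rewrite !lebesgue_measure_set1 adde0.
  apply: le_measure; rewrite ?inE//; first exact: measurableU.
  move=> z Sz /=.
  have [->|/eqP zx] := eqVneq z x; [by left|].
  have [->|/eqP zy] := eqVneq z y; [by right|].
  exfalso.
  case: (ltgtP x y) yx => // xy _; case: (ltgtP z x) zx => // zx _.
  - by apply: (@S3 z x y) => //; rewrite zx.
  - case: (ltgtP z y) zy => // zy _.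
      by apply: (@S3 x z y) => //; rewrite zx.
    by apply: (@S3 x y z) => //; rewrite xy.
  - case: (ltgtP z y) zy => // zy _.
      by apply: (@S3 z y x) => //; rewrite zy.
    by apply: (@S3 y z x) => //; rewrite zy.
  - by apply: (@S3 y x z) => //; rewrite xy.
rewrite (_ : A `&` I = (A `&` I `&` \bigcup_k F k) `|` S); last by rewrite setUIDK.
apply: (@le_trans _ _ (lam (\bigcup_k F k) + lam S)%E); last by rewrite S0 adde0.
apply: (@le_trans _ _ (lam (A `&` I `&` \bigcup_k F k) + lam S)%E).
  by apply: measureU2 => //; apply: measurableI => //; exact: bigcupT_measurable.
rewrite leeD2r//; apply: le_measure; rewrite ?inE//.
- by apply: measurableI => //; exact: bigcupT_measurable.
- exact: bigcupT_measurable.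
Qed.

Lemma lebesgue_exhaust_ge A I (d : nat -> R) (c : \bar R) :
  measurable A -> measurable I -> is_interval I -> I 0 -> dense_in A d ->
  (forall k, I (d k) -> (lam (A `&` I `&` `[d k, +oo[) <= c)%E) ->
  (lam (A `&` I) <= c)%E.
Proof.
move=> mA mI itvI I0 [d0 dA dd] dc.
have lamN E : measurable E -> lam (-%R @^-1` E) = lam E.
  by move=> mE; rewrite -[RHS]lebesgue_measureN.
have mN E : measurable E -> measurable (-%R @^-1` E).
  by move=> mE; rewrite -[X in measurable X]setTI; exact: oppr_measurable.
rewrite -lamN; last exact: measurableI.
rewrite preimage_setI; apply: (@lebesgue_exhaust_le _ _ (fun k => - d k)).
- exact: mN.
- exact: mN.
- by move=> x y Ix Iy z /andP[xz zy]; apply: (itvI _ _ Iy Ix); rewrite !lerN2 xz zy.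
- by rewrite /preimage/= oppr0.
- split; first by rewrite d0 oppr0.
    by move=> k; rewrite /preimage/= opprK.
  move=> p q x Ax /andP[px xq].
  have [|k /andP[kq pk]] := @dd (- q) (- p) (- x) Ax; first by rewrite !ltrN2 xq px.
  by exists k; rewrite ltrNr pk ltrNl.
- move=> k; rewrite /preimage/= opprK => Ik; apply: le_trans (dc k Ik).
  rewrite -[leRHS]lamN; last by apply: measurableI => //; exact: measurableI.
  rewrite !preimage_setI; apply: le_measure; rewrite ?inE.
  - by apply: measurableI => //; apply: measurableI; exact: mN.
  - by apply: measurableI; [apply: measurableI; exact: mN|exact: mN].
  - move=> x [? /=]; rewrite !in_itv/= => ?; split=> //=.
    by rewrite andbT lerNr.
Qed.

(** Let X be the part of A in I up to d_j, and Y the part of B in I from e_k on. Then (1 - l) X + l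
    e_k and (1 - l) d_j + l Y lie in C and in I, on either side of z = (1 - l) d_j + l e_k, so their
    lengths add. Exhausting A and B gives the claim. *)
Lemma line_brunn_minkowski A B C I (d e : nat -> R) (l : R) : 0 < l < 1 ->
  measurable A -> measurable B -> measurable C -> measurable I ->
  is_interval I -> I 0 -> dense_in A d -> dense_in B e ->
  (forall k y, B y -> C ((1 - l) * d k + l * y)) ->
  (forall k x, A x -> C ((1 - l) * x + l * e k)) ->
  ((1 - l)%:E * lam (A `&` I) + l%:E * lam (B `&` I) <= lam (C `&` I))%E.
Proof.
move=> /andP[l0 l1] mA mB mC mI itvI I0 dA eB CB CA.
have l1' : 0 < 1 - l by rewrite subr_gt0.
have mCI : measurable (C `&` I) by exact: measurableI.
have [dA0 dAA _] := dA; have [eB0 eBB _] := eB.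
have key j k : I (d j) -> I (e k) ->
    ((1 - l)%:E * lam (A `&` I `&` `]-oo, d j]) +
     l%:E * lam (B `&` I `&` `[e k, +oo[) <= lam (C `&` I))%E.
  move=> Ij Ik; pose z := (1 - l) * d j + l * e k.
  set X := A `&` I `&` _; set Y := B `&` I `&` _.
  have mX : measurable X by apply: measurableI => //; exact: measurableI.
  have mY : measurable Y by apply: measurableI => //; exact: measurableI.
  have Iconv x y : I x -> I y -> I ((1 - l) * x + l * y).
    move=> Ix Iy; have [xy|/ltW yx] := leP x y.
      by apply: (itvI _ _ Ix Iy); apply/andP; split; nra.
    by apply: (itvI _ _ Iy Ix); apply/andP; split; nra.
  rewrite -(@lebesgue_affine _ (1 - l) (l * e k))// -(@lebesgue_affine _ l ((1 - l) * d j))//.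
  set X' := _ @^-1` X; set Y' := _ @^-1` Y.
  have mX' : measurable X' by exact: measurable_affine_inv.
  have mY' : measurable Y' by exact: measurable_affine_inv.
  have X'P x : X' x -> (C `&` I) x /\ x <= z.
    rewrite /X' /X /affine_inv /preimage/= in_itv/=.
    set u := (x - _) / _ => -[[Au Iu] uz].
    have -> : x = (1 - l) * u + l * e k by rewrite mulrC divfK ?gt_eqF// subrK.
    by split; [split; [exact: CA|exact: Iconv]|rewrite lerD2r ler_pM2l].
  have Y'P x : Y' x -> (C `&` I) x /\ z <= x.
    rewrite /Y' /Y /affine_inv /preimage/= in_itv/= andbT.
    set u := (x - _) / _ => -[[Bu Iu] uz].
    have -> : x = (1 - l) * d j + l * u by rewrite [l * _]mulrC divfK ?gt_eqF// addrC subrK.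
    by split; [split; [exact: CB|exact: Iconv]|rewrite lerD2l ler_pM2l].
  have -> : lam Y' = lam (Y' `\` [set z]).
    transitivity (lam (Y' `\` [set z]) + lam (Y' `&` [set z]))%E.
      by apply/esym; rewrite -measureDI.
    rewrite [X in (_ + X)%E](_ : _ = 0%E) ?adde0//.
    apply/eqP; rewrite eq_le measure_ge0 andbT -(lebesgue_measure_set1 z).
    by apply: le_measure; [apply/mem_set/measurableI|apply/mem_set|exact: subIsetr].
  have <- : lam (X' `|` (Y' `\` [set z])) = (lam X' + lam (Y' `\` [set z]))%E.
    apply: measureU => //; first exact: measurableD.
    apply/seteqP; split=> x // [/X'P[_ xz] [/Y'P[_ zx]]]; apply.
    by apply/eqP; rewrite eq_le xz zx.
  apply: le_measure; rewrite ?inE//.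
    by apply: measurableU => //; exact: measurableD.
  by move=> x [/X'P[]//|[/Y'P[]]].
(* A finite right side allows subtraction, which isolates one mass for each exhaustion. *)
have [Coo|Coo] := eqVneq (lam (C `&` I)) +oo%E; first by rewrite Coo leey.
have Cfin : lam (C `&` I) \is a fin_num by rewrite ge0_fin_numE// lt_neqAle Coo leey.
have Xge0 E : (0 <= (1 - l)%:E * lam E)%E by rewrite mule_ge0// lee_fin ltW.
have Yge0 E : (0 <= l%:E * lam E)%E by rewrite mule_ge0// lee_fin ltW.
have step1 k : I (e k) -> ((1 - l)%:E * lam (A `&` I) +
     l%:E * lam (B `&` I `&` `[e k, +oo[) <= lam (C `&` I))%E.
  move=> Ik; set y := (l%:E * _)%E.
  have yC : (y <= lam (C `&` I))%E.
    by apply: le_trans (key 0%N k _ Ik); rewrite ?dA0// leeDr.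
  have yfin : y \is a fin_num by rewrite ge0_fin_numE ?Yge0// (le_lt_trans yC)// ltey_eq Cfin.
  rewrite -leeBrDr// -lee_pdivlMl//.
  apply: (lebesgue_exhaust_le mA mI itvI I0 dA) => j Ij.
  by rewrite lee_pdivlMl// leeBrDr//; exact: key.
set x := ((1 - l)%:E * lam (A `&` I))%E.
have xC : (x <= lam (C `&` I))%E.
  by apply: le_trans (step1 0%N _); rewrite ?eB0// leeDl.
have xfin : x \is a fin_num by rewrite ge0_fin_numE ?Xge0// (le_lt_trans xC)// ltey_eq Cfin.
rewrite addeC -leeBrDr// -lee_pdivlMl//.
apply: (lebesgue_exhaust_ge mB mI itvI I0 eB) => j Ij.
by rewrite lee_pdivlMl// leeBrDr// addeC; exact: step1.
Qed.

End line_sums.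

(* (1 - l) A + l B need not be Borel. Countably many translates of (1 - l) A and
   of l B, by points of countable dense subsets of B and A, form a Borel subset
   which is large enough inside every level interval of phi simultaneously. *)
Lemma unimodal_line (R : realType)
    (m : {measure set (measurableTypeR R) -> \bar R}) (phi : R -> R)
    (A B : set R) (l : R) :
  has_density (@lebesgue_measure R) m phi ->
  {in `]-oo, 0%R] &, {homo phi : x y / x <= y}} ->
  {in `[0%R, +oo[ &, {homo phi : x y / x <= y >-> y <= x}} ->
  measurable A -> measurable B -> A 0 -> B 0 -> 0 <= l <= 1 ->
  exists C : set R, [/\ measurable C,
    (forall z, C z -> exists x y, [/\ A x, B y & z = (1 - l) * x + l * y]) &
    ((1 - l)%:E * m A + l%:E * m B <= m C)%E].
Proof.
move=> [phi0 mphi mE] phiN phiP mA mB A0 B0 /andP[l0 l1].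
(* At the endpoints l = 0 and l = 1 the affine images below would divide by 0; A or B itself serves
   as C. *)
have [l_eq0|l_neq0] := eqVneq l 0.
  exists A; split=> //; last by rewrite l_eq0 subr0 mul1e mul0e adde0.
  by move=> z Az; exists z, 0; rewrite l_eq0; split=> //; ring.
have [l_eq1|l_neq1] := eqVneq l 1.
  exists B; split=> //; last by rewrite l_eq1 subrr mul1e mul0e add0e.
  by move=> z Bz; exists 0, z; rewrite l_eq1; split=> //; ring.
have {l0 l_neq0}l0 : 0 < l by rewrite lt0r l_neq0.
have {l1 l_neq1}l1 : l < 1 by rewrite lt_neqAle l_neq1.
have l1' : 0 < 1 - l by rewrite subr_gt0.
have [d dA] := dense_in_exists A0; have [e eB] := dense_in_exists B0.
pose C := (\bigcup_k affine_inv l ((1 - l) * d k) @^-1` B) `|`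
  (\bigcup_k affine_inv (1 - l) (l * e k) @^-1` A).
have mC : measurable C.
  by apply: measurableU; apply: bigcupT_measurable => k; exact: measurable_affine_inv.
exists C; split=> //.
  move=> z [[k _ Bz]|[k _ Az]].
    exists (d k), (affine_inv l ((1 - l) * d k) z); split=> //; first by case: dA.
    by rewrite /affine_inv [l * _]mulrC divfK ?gt_eqF// addrC subrK.
  exists (affine_inv (1 - l) (l * e k) z), (e k); split=> //; first by case: eB.
  by rewrite /affine_inv [X in X + _]mulrC divfK ?gt_eqF// subrK.
rewrite !mE// !layer_cake//.
have ml E := measurable_fun_layer mphi (E := E).
rewrite -!ge0_integralZl_EFin ?(ltW l0) ?(ltW l1')//; [|exact: ml..].
have mZl k E : measurable E -> measurable_fun [set: measurableTypeR R]
    (fun t => k%:E * lebesgue_measure (E `&` [set x | (0 <= t < phi x)%R]))%E.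
  by move=> mE'; apply: measurable_funeM; exact: ml.
have Z0 k E t : 0 <= k ->
    (0 <= k%:E * lebesgue_measure (E `&` [set x | (0 <= t < phi x)%R]))%E.
  by move=> k0; rewrite mule_ge0// lee_fin.
rewrite -ge0_integralD//; try by [move=> t _; apply: Z0; rewrite ltW|exact: mZl].
apply: ge0_le_integral => //.
- by move=> t _; rewrite adde_ge0// Z0// ltW.
- by apply: emeasurable_funD; exact: mZl.
- exact: ml.
move=> t _; set I := [set x | _].
have [[x Ix]|noI] := pselect (exists x, I x); last first.
  have -> : I = set0 by apply/seteqP; split=> x // Ix; apply: noI; exists x.
  by rewrite !setI0 measure0 !mule0 adde0.
have /andP[t0 tx] := Ix.
have neg y : y <= 0 -> y \in `]-oo, 0] by rewrite in_itv.
have pos y : 0 <= y -> y \in `[0, +oo[ by rewrite in_itv andbT.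
(* phi is largest at 0, so every nonempty level set contains 0. *)
have I0 : I 0.
  rewrite /I/= t0/=; apply: (lt_le_trans tx); have [x0|/ltW x0] := leP x 0.
    by apply: phiN; rewrite ?neg.
  by apply: phiP; rewrite ?pos.
have itvI : is_interval I.
  move=> y z /andP[_ ty] /andP[_ tz] w /andP[yw wz]; rewrite /I/= t0/=.
  have [w0|/ltW w0] := leP w 0.
    by apply: (lt_le_trans ty); apply: phiN; rewrite ?neg// (le_trans yw).
  by apply: (lt_le_trans tz); apply: phiP; rewrite ?pos// (le_trans w0).
have mI : measurable I.
  rewrite (_ : I = phi @^-1` `]t, +oo[).
    by rewrite -[X in measurable X]setTI; apply: mphi => //; exact: measurable_itv.
  by apply/seteqP; split=> y; rewrite /I/= in_itv/= t0 andbT.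
apply: (line_brunn_minkowski _ mA mB mC mI itvI I0 dA eB).
- by rewrite l0.
- move=> k y By; left; exists k => //; rewrite /preimage/= /affine_inv addrC addKr.
  by rewrite mulrC mulKf ?gt_eqF.
- move=> k x' Ax'; right; exists k => //; rewrite /preimage/= /affine_inv addrK.
  by rewrite mulrC mulKf ?gt_eqF.
Qed.

(** * Product measures *)

Section product_root.
Context (R : realType) (n : nat).
Implicit Types (f g : 'I_n -> \bar R).

Lemma prode_le f g : (forall i, 0 <= f i)%E -> (forall i, f i <= g i)%E ->
  (\prod_i f i <= \prod_i g i)%E.
Proof.
move=> f0 fg; suff [] : (0 <= \prod_i f i)%E /\ (\prod_i f i <= \prod_i g i)%E by [].
elim/big_rec2 : _ => [|i x y _ [y0 yx]]; first by rewrite lee_fin ler01 lexx.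
by rewrite mule_ge0// lee_pmul.
Qed.

Lemma prode_ge0 f : (forall i, 0 <= f i)%E -> (0 <= \prod_i f i)%E.
Proof. by move=> f0; elim/big_ind : _ => // x y; exact: mule_ge0. Qed.

Lemma prode_scale (c : R) f :
  (\prod_i (c%:E * f i) = (c ^+ n)%:E * \prod_i f i)%E.
Proof. by rewrite big_split/= prodEFin prodr_const card_ord. Qed.

(** As 0 * +oo = 0, an infinite factor makes the product 0 or +oo, never positive and finite. *)
Lemma prode_fin_gt0 f (x : R) : (forall i, 0 <= f i)%E -> 0 < x ->
  (\prod_i f i = x%:E)%E -> forall i, exists2 r : R, 0 < r & f i = r%:E.
Proof.
move=> f0 x0 fx i; move: fx; rewrite (bigD1 i)//=.
have : (0 <= \prod_(j < n | j != i) f j)%E.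
  by elim/big_ind : _ => // u v; exact: mule_ge0.
move: (\prod_(_ | _) _)%E => P P0.
have := f0 i; case: (f i) => [r| |]//; last first.
  have [->|Pn0] := eqVneq P 0%E; first by rewrite mule0 => _ [] x_0; rewrite -x_0 ltxx in x0.
  by rewrite gt0_mulye// lt0e Pn0.
rewrite lee_fin le_eqVlt => /predU1P[<-|r0 _]; last by exists r.
by rewrite mul0e => -[] x_0; rewrite -x_0 ltxx in x0.
Qed.

Lemma AGM_root (x : 'I_n -> R) : (0 < n)%N -> (forall i, 0 <= x i) ->
  (\prod_i x i) `^ n%:R^-1 <= (\sum_i x i) / n%:R.
Proof.
move=> n0 x0.
have s0 : 0 <= (\sum_i x i) / n%:R by rewrite divr_ge0// sumr_ge0.
have := leif_AGM (A := 'I_n) (fun i _ => x0 i); rewrite card_ord => -[+ _] => H.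
have -> : (\sum_i x i) / n%:R = (((\sum_i x i) / n%:R) ^+ n) `^ n%:R^-1.
  by rewrite -powR_mulrn// -powRrM divff ?powRr1// pnatr_eq0 -lt0n.
apply: ge0_ler_powR => //.
- by rewrite nnegrE prodr_ge0.
- by rewrite nnegrE exprn_ge0.
Qed.

(** The arithmetic-geometric mean inequality is applied to the ratios a_i / c_i and b_i / c_i with
    c_i = (1 - l) a_i + l b_i; for each i the weighted ratios add up to 1. *)
Lemma prodr_root_concave (a b : 'I_n -> R) (l : R) : (0 < n)%N -> 0 < l < 1 ->
  (forall i, 0 < a i) -> (forall i, 0 < b i) ->
  (1 - l) * (\prod_i a i) `^ n%:R^-1 + l * (\prod_i b i) `^ n%:R^-1 <=
  (\prod_i ((1 - l) * a i + l * b i)) `^ n%:R^-1.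
Proof.
move=> n0 /andP[l0 l1] a0 b0; have l1' : 0 < 1 - l by rewrite subr_gt0.
pose c i := (1 - l) * a i + l * b i.
have c0 i : 0 < c i by rewrite addr_gt0// mulr_gt0.
have C0 : 0 < (\prod_i c i) `^ n%:R^-1 by rewrite powR_gt0// prodr_gt0.
have H (x : 'I_n -> R) : (forall i, 0 < x i) -> (\prod_i x i) `^ n%:R^-1 <=
    (\sum_i x i / c i) / n%:R * (\prod_i c i) `^ n%:R^-1.
  move=> x0; have xc0 i : 0 <= x i / c i by rewrite divr_ge0// ltW.
  apply: le_trans (ler_wpM2r (ltW C0) (AGM_root n0 xc0)).
  rewrite -powRM; [|by rewrite prodr_ge0|by rewrite prodr_ge0// => i _; rewrite ltW].
  rewrite -big_split/=; under [in leRHS]eq_bigr do rewrite divfK ?gt_eqF//.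
  exact: lexx.
apply: le_trans (lerD (ler_wpM2l (ltW l1') (H a a0)) (ler_wpM2l (ltW l0) (H b b0))) _.
rewrite !mulrA -mulrDl -[leRHS]mul1r ler_wpM2r ?(ltW C0)//.
rewrite -mulrDl !mulr_sumr -big_split/= (eq_bigr (fun=> 1)) => [|i _]; last first.
  by rewrite !mulrA -mulrDl -/(c i) divff ?gt_eqF.
by rewrite sumr_const card_ord divff ?pnatr_eq0 -?lt0n.
Qed.

Lemma poweR_root_scale (c : R) (x : \bar R) : (0 < n)%N -> 0 <= c -> (0 <= x)%E ->
  (((c ^+ n)%:E * x) `^ n%:R^-1 = c%:E * x `^ n%:R^-1)%E.
Proof.
move=> n0 c0 x0; rewrite poweRM ?lee_fin ?exprn_ge0// poweR_EFin.
by rewrite -powR_mulrn// -powRrM divff ?powRr1// pnatr_eq0 -lt0n.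
Qed.

(** If both products are positive and finite, so are all factors and the real inequality applies.
    Otherwise [fh] or [gh] alone suffices: either one product is 0, or the right side is
    infinite. *)
Lemma prode_root_concave f g (l : R) : (0 < n)%N -> 0 <= l <= 1 ->
  (forall i, 0 <= f i)%E -> (forall i, 0 <= g i)%E ->
  ((1 - l)%:E * (\prod_i f i) `^ n%:R^-1 + l%:E * (\prod_i g i) `^ n%:R^-1 <=
   (\prod_i ((1 - l)%:E * f i + l%:E * g i)) `^ n%:R^-1)%E.
Proof.
move=> n0 /andP[l0 l1] f0 g0.
have [->|l_neq0] := eqVneq l 0.
  rewrite subr0 mul1e mul0e adde0 le_eqVlt; apply/orP; left; apply/eqP.
  by congr poweR; apply: eq_bigr => i _; rewrite mul1e mul0e adde0.
have [->|l_neq1] := eqVneq l 1.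
  rewrite subrr mul1e mul0e add0e le_eqVlt; apply/orP; left; apply/eqP.
  by congr poweR; apply: eq_bigr => i _; rewrite mul1e mul0e add0e.
have {l0 l_neq0}l0 : 0 < l by rewrite lt0r l_neq0.
have {l1 l_neq1}l1 : l < 1 by rewrite lt_neqAle l_neq1.
have l1' : 0 < 1 - l by rewrite subr_gt0.
have n0' : 0 < n%:R^-1 :> R by rewrite invr_gt0 ltr0n.
set h := fun i => ((1 - l)%:E * f i + l%:E * g i)%E.
have lf i : (0 <= (1 - l)%:E * f i)%E by rewrite mule_ge0// lee_fin ltW.
have lg i : (0 <= l%:E * g i)%E by rewrite mule_ge0// lee_fin ltW.
have fh : ((1 - l)%:E * (\prod_i f i) `^ n%:R^-1 <= (\prod_i h i) `^ n%:R^-1)%E.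
  rewrite -poweR_root_scale// ?(ltW l1')// ?prode_ge0// -prode_scale.
  by apply: le_poweR; [exact: ltW|exact: prode_ge0|apply: prode_le => // i; rewrite leeDl].
have gh : (l%:E * (\prod_i g i) `^ n%:R^-1 <= (\prod_i h i) `^ n%:R^-1)%E.
  rewrite -poweR_root_scale// ?(ltW l0)// ?prode_ge0// -prode_scale.
  by apply: le_poweR; [exact: ltW|exact: prode_ge0|apply: prode_le => // i; rewrite leeDr].
case fE : (\prod_i f i)%E (prode_ge0 f0) => [x| |]//.
- rewrite lee_fin le_eqVlt => /predU1P[x0|x0].
    by rewrite -x0 poweR0r ?gt_eqF// mule0 add0e.
  case gE : (\prod_i g i)%E (prode_ge0 g0) => [y| |]//.
  + rewrite lee_fin le_eqVlt => /predU1P[y0|y0].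
      by rewrite -y0 poweR0r ?gt_eqF// mule0 adde0 -fE.
    have [a a0 fa] : exists2 a : 'I_n -> R, (forall i, 0 < a i) & f = EFin \o a.
      have H := prode_fin_gt0 f0 x0 fE.
      exists (fun i => sval (cid2 (H i))) => [i|]; first by case: cid2.
      by apply/funext => i /=; case: cid2.
    have [b b0 gb] : exists2 b : 'I_n -> R, (forall i, 0 < b i) & g = EFin \o b.
      have H := prode_fin_gt0 g0 y0 gE.
      exists (fun i => sval (cid2 (H i))) => [i|]; first by case: cid2.
      by apply/funext => i /=; case: cid2.
    rewrite -fE -gE /h fa gb /= !prodEFin.
    rewrite !poweR_EFin -!EFinM -EFinD lee_fin.
    by apply: prodr_root_concave; rewrite ?l0.
  + by move=> _; move: gh; rewrite gE poweRyr ?gt_eqF// gt0_muley ?lte_fin//.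
- move=> _; move: fh; rewrite fE poweRyr ?gt_eqF// gt0_muley ?lte_fin//.
  by rewrite leye_eq => /eqP ->; rewrite leey.
Qed.

End product_root.

(** The box of the one-dimensional sets C_i is Borel and, splitting each coordinate, lies in the
    Minkowski sum; its mass therefore bounds the outer measure from below. *)
Lemma product_concave (R : realType) (n : nat)
    (mu_ : 'I_n -> {measure set (measurableTypeR R) -> \bar R})
    (phi : 'I_n -> R -> R) (mu : {measure set 'rV[R]_n -> \bar R})
    (A B : 'I_n -> set R) (l : R) : (0 < n)%N ->
  (forall i, has_density (@lebesgue_measure R) (mu_ i) (phi i)) ->
  (forall i, {in `]-oo, 0%R] &, {homo phi i : x y / x <= y}}) ->
  (forall i, {in `[0%R, +oo[ &, {homo phi i : x y / x <= y >-> y <= x}}) ->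
  is_product_measure mu_ mu ->
  (forall i, measurable (A i)) -> (forall i, measurable (B i)) ->
  (box A `&` box B) 0 -> 0 <= l <= 1 ->
  ((1 - l)%:E * mu (box A) `^ n%:R^-1 + l%:E * mu (box B) `^ n%:R^-1 <=
   mu^* (minkowski_sum (dilate (1 - l) (box A)) (dilate l (box B))) `^ n%:R^-1)%E.
Proof.
move=> n0 dphi phiN phiP muE mA mB [A0 B0] l01.
have lineC i : exists C : set R, [/\ measurable C,
    (forall z, C z -> exists x y, [/\ A i x, B i y & z = (1 - l) * x + l * y]) &
    ((1 - l)%:E * mu_ i (A i) + l%:E * mu_ i (B i) <= mu_ i C)%E].
  apply: unimodal_line (dphi i) (phiN i) (phiP i) (mA i) (mB i) _ _ l01.
    by have := A0 i; rewrite mxE.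
  by have := B0 i; rewrite mxE.
have [C /all_and3[mC CAB muC]] := choice lineC.
have /andP[l0 l1] := l01.
have Cge0 i : (0 <= (1 - l)%:E * mu_ i (A i) + l%:E * mu_ i (B i))%E.
  by rewrite adde_ge0// mule_ge0// lee_fin ?subr_ge0.
rewrite (muE _ mA) (muE _ mB).
apply: (le_trans (prode_root_concave n0 l01 _ _)) => //.
apply: le_poweR; [by rewrite invr_ge0|exact: prode_ge0|].
apply: (le_trans (prode_le Cge0 muC)); rewrite -(muE _ mC).
rewrite -measurable_mu_extE; last exact: measurable_box.
apply: le_mu_ext => z Cz.
have /choice[x /choice[y xyP]] : forall i, exists x y,
    [/\ A i x, B i y & z ord0 i = (1 - l) * x + l * y].
  by move=> i; exact/CAB/Cz.
exists ((1 - l) *: \row_i x i).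
  by exists (\row_i x i) => // i; rewrite mxE; have [] := xyP i.
exists (l *: \row_i y i).
  by exists (\row_i y i) => // i; rewrite mxE; have [] := xyP i.
by apply/rowP => i; rewrite !mxE; have [] := xyP i.
Qed.

Theorem theorem1 (R : realType) (n : nat) (n_ge1 : (1 <= n)%N) :
  (forall (mu : {measure set 'rV[R]_n -> \bar R}) (A : set 'rV[R]_n),
      unconditional_measure mu -> log_concave_measure mu ->
      unconditional_set A -> convex_set A ->
      forall A1 A2 : set 'rV[R]_n,
        [set dilate a A | a in [set a : R | 0 < a]] A1 ->
        [set dilate a A | a in [set a : R | 0 < a]] A2 ->
      forall l : R, 0 <= l <= 1 ->
        ((1 - l)%:E * mu^* A1 `^ n%:R^-1 + l%:E * mu^* A2 `^ n%:R^-1 <=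
         mu^* (minkowski_sum (dilate (1 - l) A1) (dilate l A2)) `^ n%:R^-1)%E)
  /\
  (forall (mu_ : 'I_n -> {measure set (measurableTypeR R) -> \bar R})
          (phi : 'I_n -> R -> R) (mu : {measure set 'rV[R]_n -> \bar R})
          (A_ B_ : 'I_n -> set R) (A B : set 'rV[R]_n),
      (forall i, has_density (@lebesgue_measure R) (mu_ i) (phi i)) ->
      (forall i, {in `]-oo, 0%R] &, {homo phi i : x y / x <= y}}) ->
      (forall i, {in `[0%R, +oo[ &, {homo phi i : x y / x <= y >-> y <= x}}) ->
      is_product_measure mu_ mu ->
      (forall i, measurable (A_ i)) -> A = box A_ ->
      (forall i, measurable (B_ i)) -> B = box B_ ->
      (A `&` B) 0 ->
      forall l : R, 0 <= l <= 1 ->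
        ((1 - l)%:E * mu A `^ n%:R^-1 + l%:E * mu B `^ n%:R^-1 <=
         mu^* (minkowski_sum (dilate (1 - l) A) (dilate l B)) `^ n%:R^-1)%E).
Proof.
split=> [mu A unc_mu mu_lc unc_A convex_A|].
  exact: homothetic_concave.
move=> mu_ phi mu A_ B_ A B dphi phiN phiP muE mA -> mB -> AB0 l l01.
exact: product_concave AB0 l01.
Qed.
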